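(* Let $k$ be a field and let $E_{g,n}$ ($1\le n\le g$) be the graded $k$-algebra described in the context. (i) For every $g\ge 1$ one has $HH^i(E_{g,g})_{2-i}=0$ for all $i>8$. If $g>1$, then $HH^i(E_{g,g})_{2-i}=0$ for all $i>6$. (ii) Assume $1\le n<g$. Then $HH^i(E_{g,n})_{2-i}\neq 0$ for all $i\ge 5$.
   Context: For integers $1\le n\le g$, $E_{g,n}$ is the graded associative $k$-algebra with $k$-basis: orthogonal idempotents $e_{\mathcal O}, e_1,\ldots,e_n$ (degree $0$, summing to $1$), elements $A_i$ of degree $0$, $B_i$ of degree $1$, $Y_i$ of degree $1$ ($1\le i\le n$), and $X_j$ of degree $1$ ($1\le j\le g$). Here $A_i\in e_iE e_{\mathcal O}$, $B_i\in e_{\mathcal O}E e_i$, $Y_i\in e_iEe_i$, $X_j\in e_{\mathcal O}Ee_{\mathcal O}$ (where $E=E_{g,n}$), and apart from the relations with the idempotents the only nonzero products of basis elements are $A_iB_i=Y_i$ and $B_iA_i=X_i$ for $i=1,\ldots,n$. (This is the algebra $\mathrm{Ext}^*(G,G)$ for $G=\mathcal O_C\oplus\mathcal O_{p_1}\oplus\cdots\oplus\mathcal O_{p_n}$ on a projective curve $C$ of arithmetic genus $g$ with distinct smooth points $p_1,\ldots,p_n$ such that $h^0(p_1+\cdots+p_n)=1$.) For a graded algebra $A$, $HH^i(A)_j$ denotes the component of internal degree $j$ of the $i$th Hochschild cohomology $HH^i(A)=H^i(A,A)$, i.e. the part computed by cochains $A^{\otimes i}\to A$ that are homogeneous of degree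 $j$ with respect to the grading of $A$. *)

(* Defs.v *)
From HB Require Import structures.
From mathcomp Require Import all_boot all_order all_algebra all_field.

Set Implicit Arguments.
Unset Strict Implicit.
Unset Printing Implicit Defensive.

Import GRing.Theory.
Local Open Scope ring_scope.

Section Hochschild.

(* [gr d] is the subspace of homogeneous elements of degree [d] of [A]. *)
Variables (k : fieldType) (A : falgType k) (gr : int -> {vspace A}).

(* Cochains, i.e. linear maps A^(tensor i) -> A, are represented by the
   corresponding multilinear maps. *)
Definition upd i (a : {ffun 'I_i -> A}) (s : 'I_i) (x : A) : {ffun 'I_i -> A} :=
  [ffun t => if t == s then x else a t].

Definition multilinear i (f : {ffun 'I_i -> A} -> A) : Prop :=
  forall (s : 'I_i) (a : {ffun 'I_i -> A}) (c : k) (x y : A),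
    f (upd a s (c *: x + y)) = c *: f (upd a s x) + f (upd a s y).

Definition homogeneous_args i (d : 'I_i -> int) (a : {ffun 'I_i -> A}) : Prop :=
  forall s, a s \in gr (d s).

Definition homogeneous_map i (j : int) (f : {ffun 'I_i -> A} -> A) : Prop :=
  forall (d : 'I_i -> int) (a : {ffun 'I_i -> A}),
    homogeneous_args d a -> f a \in gr ((\sum_s d s) + j).

Definition cochain i (j : int) (f : {ffun 'I_i -> A} -> A) : Prop :=
  multilinear f /\ homogeneous_map j f.

(* (a_0, ..., a_t a_(t+1), ..., a_i) *)
Definition merge i (t : 'I_i) (a : {ffun 'I_i.+1 -> A}) : {ffun 'I_i -> A} :=
  [ffun s : 'I_i => if (s < t)%N then a (lift ord_max s)
             else if s == t then a (lift ord_max s) * a (lift ord0 s)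
             else a (lift ord0 s)].

(* The Hochschild differential of an i-cochain of internal degree j, evaluated
   at homogeneous arguments a_0, ..., a_i of degrees d_0, ..., d_i:
     (-1)^(j d_0) a_0 f(a_1, ..., a_i)
       + \sum_(t < i) (-1)^(t+1) f(a_0, ..., a_t a_(t+1), ..., a_i)
       + (-1)^(i+1) f(a_0, ..., a_(i-1)) a_i.
   The sign in the first term is the Koszul sign for exchanging f and a_0.
   Since A is spanned by homogeneous elements, these values determine the
   multilinear map. *)
Definition hochschild_diff i (j : int) (f : {ffun 'I_i -> A} -> A)
    (d : 'I_i.+1 -> int) (a : {ffun 'I_i.+1 -> A}) : A :=
  ((-1 : k) ^ (j * d ord0)) *: (a ord0 * f [ffun s : 'I_i => a (lift ord0 s)])
  + \sum_(t < i) ((-1 : k) ^+ t.+1) *: f (merge t a)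
  + ((-1 : k) ^+ i.+1) *: (f [ffun s : 'I_i => a (lift ord_max s)] * a ord_max).

Definition cocycle i (j : int) (f : {ffun 'I_i -> A} -> A) : Prop :=
  cochain j f /\
  forall (d : 'I_i.+1 -> int) (a : {ffun 'I_i.+1 -> A}),
    homogeneous_args d a -> hochschild_diff j f d a = 0.

Definition coboundary i (j : int) : ({ffun 'I_i -> A} -> A) -> Prop :=
  match i return ({ffun 'I_i -> A} -> A) -> Prop with
  | 0 => fun f => forall a, f a = 0
  | i'.+1 => fun f => exists b : {ffun 'I_i' -> A} -> A,
      cochain j b /\
      forall (d : 'I_i'.+1 -> int) (a : {ffun 'I_i'.+1 -> A}),
        homogeneous_args d a -> f a = hochschild_diff j b d a
  end.

(* HH^i(A)_j = 0 *)
Definition HH_eq0 (i : nat) (j : int) : Prop :=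
  forall f : {ffun 'I_i -> A} -> A, cocycle j f -> coboundary j f.

End Hochschild.

Section Basis.
Variables g n : nat.

(* The vertex [None] stands for O and [Some i] for p_i; [bE] gives the
   idempotents. *)
Inductive Ebasis : Type :=
  | bE of option 'I_n | bA of 'I_n | bB of 'I_n | bY of 'I_n | bX of 'I_g.

Definition Ebasis_code (b : Ebasis) :
    (option 'I_n + 'I_n) + ('I_n + 'I_n) + 'I_g :=
  match b with
  | bE v => inl (inl (inl v)) | bA i => inl (inl (inr i))
  | bB i => inl (inr (inl i)) | bY i => inl (inr (inr i)) | bX j => inr j
  end.
Definition Ebasis_decode
    (c : (option 'I_n + 'I_n) + ('I_n + 'I_n) + 'I_g) : Ebasis :=
  match c with
  | inl (inl (inl v)) => bE v | inl (inl (inr i)) => bA i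
  | inl (inr (inl i)) => bB i | inl (inr (inr i)) => bY i | inr j => bX j
  end.
Lemma Ebasis_codeK : cancel Ebasis_code Ebasis_decode.
Proof. by case. Qed.

HB.instance Definition _ := Finite.copy Ebasis (can_type Ebasis_codeK).

(* b lies in e_v E e_w with v = Eleft b and w = Eright b. *)
Definition Eleft (b : Ebasis) : option 'I_n :=
  match b with
  | bE v => v | bA i => Some i | bB _ => None | bY i => Some i | bX _ => None
  end.
Definition Eright (b : Ebasis) : option 'I_n :=
  match b with
  | bE v => v | bA _ => None | bB i => Some i | bY i => Some i | bX _ => None
  end.

Definition Edeg (b : Ebasis) : nat :=
  match b with bE _ | bA _ => 0 | bB _ | bY _ | bX _ => 1 end.

(* [None] is the zero product.  In the product B_i A_i = X_i the index i < n
   is read as an index < g, which always succeeds when n <= g. *)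
Definition Ebasis_mul (b c : Ebasis) : option Ebasis :=
  match b, c with
  | bE v, _ => if Eleft c == v then Some c else None
  | _, bE v => if Eright b == v then Some b else None
  | bA i, bB j => if i == j then Some (bY i) else None
  | bB i, bA j => if i == j then omap bX (insub (val i)) else None
  | _, _ => None
  end.

Lemma Ebasis_mulA b c d :
  obind (fun x => Ebasis_mul x d) (Ebasis_mul b c) =
  obind (Ebasis_mul b) (Ebasis_mul c d).
Proof.
case: b => [v|i|i|i|i]; case: c => [w|i'|i'|i'|i']; case: d => [u|j|j|j|j] //=.
all: repeat (match goal with
             | |- context [?a == ?b] =>
               case: (@eqP _ a b) => ? //=; try congruence
             | |- context [insub ?u] => case: (insub u) => [?|] //=
             end).
Qed.

End Basis.

Section Algebra.
Variables (k : fieldType) (g n : nat).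

(* The algebra E_(g,n); an element is the family of its coordinates. *)
Definition Egn : Type := {ffun Ebasis g n -> k^o}.

HB.instance Definition _ := Vector.on Egn.

Definition Evec (b : Ebasis g n) : Egn := [ffun c => (c == b)%:R].

Definition Emul (x y : Egn) : Egn :=
  \sum_b \sum_c (x b * y c) *: oapp Evec 0 (Ebasis_mul b c).

Definition Eone : Egn := \sum_(v : option 'I_n) Evec (bE g v).

Lemma Evec_sum (x : Egn) : x = \sum_b x b *: Evec b.
Proof.
apply/ffunP => c; rewrite sum_ffunE (bigD1 c) //= big1 => [|b bc].
  by rewrite !ffunE eqxx addr0 [_ *: _]mulr1.
by rewrite !ffunE eq_sym (negPf bc) scaler0.
Qed.

Fact EmulDl : left_distributive Emul +%R.
Proof.
move=> x y z; rewrite /Emul -big_split; apply: eq_bigr => b _ /=.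
by rewrite -big_split; apply: eq_bigr => c _ /=; rewrite ffunE mulrDl scalerDl.
Qed.

Fact EmulDr : right_distributive Emul +%R.
Proof.
move=> x y z; rewrite /Emul -big_split; apply: eq_bigr => b _ /=.
by rewrite -big_split; apply: eq_bigr => c _ /=; rewrite ffunE mulrDr scalerDl.
Qed.

Fact EmulZl (a : k) x y : a *: Emul x y = Emul (a *: x) y.
Proof.
rewrite /Emul scaler_sumr; apply: eq_bigr => b _; rewrite scaler_sumr.
by apply: eq_bigr => c _; rewrite ffunE scalerA mulrA.
Qed.

Fact EmulZr (a : k) x y : a *: Emul x y = Emul x (a *: y).
Proof.
rewrite /Emul scaler_sumr; apply: eq_bigr => b _; rewrite scaler_sumr.
by apply: eq_bigr => c _; rewrite ffunE scalerA mulrCA.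
Qed.

Fact Emul0l y : Emul 0 y = 0.
Proof. by rewrite -[in LHS](scale0r 0) -EmulZl scale0r. Qed.

Fact Emul0r y : Emul y 0 = 0.
Proof. by rewrite -[in LHS](scale0r 0) -EmulZr scale0r. Qed.

Fact Emul_suml (I : Type) (r : seq I) (F : I -> Egn) y :
  Emul (\sum_(i <- r) F i) y = \sum_(i <- r) Emul (F i) y.
Proof.
by apply: (big_morph (Emul^~ y)) => [u v|]; [apply: EmulDl | apply: Emul0l].
Qed.

Fact Emul_sumr (I : Type) (r : seq I) (F : I -> Egn) x :
  Emul x (\sum_(i <- r) F i) = \sum_(i <- r) Emul x (F i).
Proof.
by apply: (big_morph (Emul x)) => [u v|]; [apply: EmulDr | apply: Emul0r].
Qed.

Lemma Emul_vec b c : Emul (Evec b) (Evec c) = oapp Evec 0 (Ebasis_mul b c).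
Proof.
rewrite /Emul (bigD1 b) //= (bigD1 c) //= !ffunE !eqxx mulr1 scale1r.
rewrite !big1 ?addr0 // => [b' bb'|c' cc'].
  by rewrite big1 // => c' _; rewrite !ffunE (negPf bb') mul0r scale0r.
by rewrite !ffunE (negPf cc') mulr0 scale0r.
Qed.

Fact EmulA : associative Emul.
Proof.
have := (Emul_suml, Emul_sumr, EmulZl, EmulZr).
have : forall b c d, Emul (Evec b) (Emul (Evec c) (Evec d)) =
                     Emul (Emul (Evec b) (Evec c)) (Evec d).
  move=> b c d; rewrite !Emul_vec; have := Ebasis_mulA b c d.
  case: (Ebasis_mul b c) => [bc|]; case: (Ebasis_mul c d) => [cd|] /=;
    rewrite ?Emul_vec ?Emul0l ?Emul0r //.
  - by move->.
  - by move->.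
  - by move<-.
move: Emul => m mA [[[suml sumr] mZl] mZr] x y z.
rewrite [x]Evec_sum !suml; apply: eq_bigr => b _.
rewrite -!mZl; congr (_ *: _).
rewrite [y]Evec_sum suml !sumr suml; apply: eq_bigr => c _.
rewrite -!mZl -!mZr -?mZl; congr (_ *: _).
rewrite [z]Evec_sum !sumr; apply: eq_bigr => d _.
by rewrite -!mZr mA.
Qed.

Fact Emul1l : left_id Eone Emul.
Proof.
move=> x; rewrite [x in LHS]Evec_sum Emul_sumr.
rewrite [RHS]Evec_sum; apply: eq_bigr => b _; rewrite -EmulZr.
congr (_ *: _); rewrite Emul_suml.
rewrite (bigD1 (Eleft b)) //= Emul_vec /= eqxx big1 ?addr0 // => v bv.
by rewrite Emul_vec /= eq_sym (negPf bv).
Qed.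

Lemma Ebasis_mule (b : Ebasis g n) v :
  Ebasis_mul b (bE g v) = if Eright b == v then Some b else None.
Proof.
by case: b => //= u; rewrite eq_sym; case: eqP => [->|].
Qed.

Fact Emul1r : right_id Eone Emul.
Proof.
move=> x; rewrite [x in LHS]Evec_sum Emul_suml.
rewrite [RHS]Evec_sum; apply: eq_bigr => b _; rewrite -EmulZl.
congr (_ *: _); rewrite Emul_sumr.
rewrite (bigD1 (Eright b)) //= Emul_vec Ebasis_mule eqxx big1 ?addr0 // => v bv.
by rewrite Emul_vec Ebasis_mule eq_sym (negPf bv).
Qed.

Fact Eone_neq0 : Eone != 0.
Proof.
apply/eqP => /ffunP /(_ (bE g None)); rewrite sum_ffunE (bigD1 None) //=.
rewrite !ffunE eqxx big1 ?addr0 => [/eqP|v vN]; first by rewrite oner_eq0.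
rewrite ffunE; case: eqP => [[vE]|//].
by rewrite -vE eqxx in vN.
Qed.

HB.instance Definition _ := GRing.Zmodule_isNzRing.Build Egn
  EmulA Emul1l Emul1r EmulDl EmulDr Eone_neq0.
HB.instance Definition _ := GRing.Lmodule_isLalgebra.Build k Egn EmulZl.
HB.instance Definition _ := GRing.Lalgebra_isAlgebra.Build k Egn EmulZr.
HB.instance Definition _ := Algebra_isFalgebra.Build k Egn.

Definition Egr (d : int) : {vspace Egn} :=
  <<[seq Evec b | b in [pred b : Ebasis g n | (Edeg b)%:Z == d]]>>%VS.

Lemma Egr_vec b : Evec b \in Egr (Edeg b).
Proof. by apply: memv_span; apply: image_f; rewrite inE. Qed.

Lemma Egr_mul (d e : int) : (Egr d * Egr e <= Egr (d + e))%VS.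
Proof.
apply/prodvP => x y /coord_span -> /coord_span ->.
rewrite mulr_suml memv_suml // => s _; rewrite mulr_sumr memv_suml // => t _.
rewrite -scalerAl -scalerAr; do 2!apply: memvZ.
have /imageP[b bd ->] : [seq Evec b | b in [pred b | (Edeg b)%:Z == d]]`_s
    \in [seq Evec b | b in [pred b | (Edeg b)%:Z == d]] by rewrite mem_nth ?size_image.
have /imageP[c ce ->] : [seq Evec b | b in [pred b | (Edeg b)%:Z == e]]`_t
    \in [seq Evec b | b in [pred b | (Edeg b)%:Z == e]] by rewrite mem_nth ?size_image.
move: bd ce; rewrite !inE => /eqP<- /eqP<-.
have -> : Evec b * Evec c = oapp Evec 0 (Ebasis_mul b c) by exact: Emul_vec.
case bc: (Ebasis_mul b c) => [f|] /=; last exact: mem0v.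
have -> : (Edeg b)%:Z + (Edeg c)%:Z = (Edeg f)%:Z; last exact: Egr_vec.
rewrite -PoszD; congr Posz; move: bc.
case: b => [v|i|i|i|i]; case: c => [w|i'|i'|i'|i'] //=;
  case: ifP => // _; try by case=> <-.
by case: insub => //= ? [<-].
Qed.

Lemma Evec_AB i : Evec (bA g i) * Evec (bB g i) = Evec (bY g i).
Proof. by rewrite [LHS]Emul_vec /= eqxx. Qed.

Lemma Evec_BA (le_ng : (n <= g)%N) i :
  Evec (bB g i) * Evec (bA g i) = Evec (bX n (widen_ord le_ng i)).
Proof.
rewrite [LHS]Emul_vec /= eqxx insubT ?(leq_trans (ltn_ord i)) // => lt_ig /=.
Qed.

End Algebra.

(* Main.v *)
Require Import Defs.
From mathcomp Require Import all_boot all_order all_algebra all_field.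
From mathcomp Require Import ring zify.

(** A multilinear cochain is determined by its values on words in the basis of
    [E_(g,n)], and filtering the values by the basis element hit reduces the
    Hochschild complex to complexes of scalar functions on words, whose
    coefficients are simple bimodules [e_v (E / rad E) e_u].

    When [n = g] the algebra is monomial, with relations [A_i B_j] ([i <> j]),
    [A_i B_i A_i] and [B_i A_i B_i].  Reading words from the left, syzygies of
    simple and of cyclic right modules are again sums of such modules, and this
    dimension shift shows that a scalar cocycle is a coboundary as soon as it
    vanishes on the critical words: those in which each letter follows the
    previous one by [X -> B_j], [B_i -> Y_i], [Y_i -> A_i], [A_i -> X_i] or
    [A_i -> B_j] ([j <> i]).  In internal degree [2 - i] a relevant critical
    word has at most two letters [A], hence length at most 8, and for lengths 7
    and 8 only idempotent values remain.  All adjacent products in a critical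
    word vanish, so for [g > 1] the cocycle identity on words obtained by
    appending or splitting letters forces these values to be 0.

    When [n < g] there is a loop [Z = X_j] with [j > n].  The cochain with value
    [X_1] on the words [Z B_1 Y_1 A_1 Z^b] and [Z X_1 B_1 A_1 Z^b] is a cocycle.
    All adjacent products in the first word vanish and the word begins and ends
    with [Z], so on it a coboundary takes values in [Z E + E Z], which do not
    involve [X_1]. *)

Set Implicit Arguments.
Unset Strict Implicit.
Unset Printing Implicit Defensive.

Import GRing.Theory.
Local Open Scope ring_scope.

(** * Words in the basis and scalar differentials *)

Section Words.
Variables g n : nat.
Local Notation B := (Ebasis g n).

Lemma eq_EbasisE (b c : B) : (b == c) =
  match b, c with
  | bE v, bE w => v == w | bA i, bA j | bB i, bB j | bY i, bY j => i == j
  | bX i, bX j => i == j | _, _ => false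
  end.
Proof. by case: b => ?; case: c. Qed.

Lemma mul_Eleft (x y z : B) : Ebasis_mul x y = Some z -> Eleft z = Eleft x.
Proof.
case: x => [v|i|i|i|i]; case: y => [w|h|h|h|h] //=; case: eqP => // ?; try by case=> <-.
by case: insub => //= ? [<-].
Qed.

Section Merges.
Variables (V : zmodType) (e : V -> B -> V).

Definition merge_head (F : seq B -> V) (x : B) (r : seq B) : V :=
  if r is y :: s then oapp (fun z => F (z :: s)) 0 (Ebasis_mul x y)
  else e (F [::]) x.

(* The alternating sum of [F] over the products of adjacent letters of [w],
   together with the term in which the last letter acts by [e]. *)
Fixpoint merges (F : seq B -> V) (w : seq B) : V :=
  if w is x :: r then merge_head F x r - merges (F \o cons x) r else 0.

Lemma merges_cons F x r : merges F (x :: r) = merge_head F x r - merges (F \o cons x) r.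
Proof. by []. Qed.

Lemma eq_merges F G w :
  (forall t, (size t).+1 = size w -> F t = G t) -> merges F w = merges G w.
Proof.
elim: w F G => //= x r IH F G FG; congr (_ - _).
  case: r {IH} FG => [|y s] FG /=; first by rewrite FG.
  by case: Ebasis_mul => //= z; apply: FG.
by apply: IH => t /= ts; apply: FG; rewrite /= ts.
Qed.

Lemma merges0 F w : (forall x, e 0 x = 0) ->
  (forall t, (size t).+1 = size w -> F t = 0) -> merges F w = 0.
Proof.
move=> e0 F0; elim: w F F0 => //= x r IH F F0; rewrite IH ?subr0; last first.
  by move=> t ts; apply: F0; rewrite /= ts.
case: r {IH} F0 => [|y s] F0 /=; first by rewrite F0.
by case: Ebasis_mul => //= z; apply: F0.
Qed.

Hypothesis eD : forall b, {morph e^~ b : y z / y + z}.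

Lemma act0 b : e 0 b = 0.
Proof. by apply: (addIr (e 0 b)); rewrite -eD addr0 add0r. Qed.

Lemma mergesD F G w : merges (fun t => F t + G t) w = merges F w + merges G w.
Proof.
elim: w F G => [|x r IH] F G; first by rewrite addr0.
rewrite !merges_cons; have -> := IH (F \o cons x) (G \o cons x).
rewrite opprD addrACA; congr (_ + _).
case: r {IH} => [|y s] /=; first exact: eD.
by case: Ebasis_mul => //=; rewrite addr0.
Qed.

Lemma mergesN F w : merges (fun t => - F t) w = - merges F w.
Proof.
apply/eqP; rewrite -addr_eq0 -mergesD merges0 // => [b|t _]; first exact: act0.
exact: addNr.
Qed.

End Merges.

Section Scalar.
Variables (k : fieldType) (u : option 'I_n).
Implicit Types (F : seq B -> k) (w r : seq B) (x : option 'I_n).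

Definition simple_act (a : k) (b : B) : k := (b == bE g u)%:R * a.
Local Notation mergesk := (merges simple_act).
Local Notation merge_headk := (merge_head simple_act).

(** The empty word carries the vertex [u], because an idempotent standing last acts on the value
    through [simple_act]. *)
Definition headv r := if r is y :: _ then Eleft y else u.

Lemma simple_act0 b : simple_act 0 b = 0. Proof. exact: mulr0. Qed.

Lemma merge_head_idem F x r : merge_headk F (bE g x) r = (headv r == x)%:R * F r.
Proof.
case: r => [|y s] /=; first by rewrite /simple_act eq_sym; congr (_%:R * _).
by case: ifP => _ /=; rewrite ?mul1r ?mul0r.
Qed.

(* The differential on cochains with values in [Hom(S_x, S_u)], where [S_x] is
   the simple right module at the vertex [x]. *)
Definition simple_diff x F w : k :=
  if w is y :: r then (y == bE g x)%:R * F r - mergesk F w else 0.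

(* The analogue for a right module with a basis of letters [c], on which the
   algebra acts by [Ebasis_mul]; [F c w] is the value at [c]. *)
Definition cyclic_diff (F : B -> seq B -> k) (c : B) (w : seq B) : k :=
  if w is y :: r then oapp (F^~ r) 0 (Ebasis_mul c y) - mergesk (F c) w else 0.

Lemma mergeskD F G w : mergesk (fun t => F t + G t) w = mergesk F w + mergesk G w.
Proof. by apply: mergesD => b y z; apply: mulrDr. Qed.

Lemma mergeskN F w : mergesk (fun t => - F t) w = - mergesk F w.
Proof. by apply: mergesN => b y z; apply: mulrDr. Qed.

Lemma eq_simple_diff x F G w : (forall t, F t = G t) -> simple_diff x F w = simple_diff x G w.
Proof. by case: w => // y r FG; rewrite /simple_diff FG (eq_merges _ (fun t _ => FG t)). Qed.

Lemma simple_diff0 x F w : (forall t, F t = 0) -> simple_diff x F w = 0.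
Proof.
case: w => // y r F0; rewrite /simple_diff F0 mulr0 merges0 ?subr0 // => b; exact: simple_act0.
Qed.

Lemma simple_diffD x F G w : simple_diff x (fun t => F t + G t) w =
  simple_diff x F w + simple_diff x G w.
Proof.
case: w => [|y r]; first by rewrite addr0.
by rewrite /simple_diff mergeskD mulrDr opprD addrACA.
Qed.

Lemma cyclic_diffD (F G : B -> seq B -> k) c w :
  cyclic_diff (fun q t => F q t + G q t) c w = cyclic_diff F c w + cyclic_diff G c w.
Proof.
case: w => [|y r]; first by rewrite addr0.
rewrite /cyclic_diff mergeskD opprD addrACA; congr (_ + _).
by case: Ebasis_mul => //=; rewrite addr0.
Qed.

Lemma merges_cons0 F b r : (forall t, F (b :: t) = 0) -> mergesk (F \o cons b) r = 0.
Proof. by move=> Fx; apply: merges0 => [c|t _]; [exact: simple_act0 | exact: Fx]. Qed.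

End Scalar.
End Words.

(** * Dimension shifting for the monomial algebra [n = g] *)

Section Exactness.
Variables (n : nat) (k : fieldType) (u : option 'I_n).
Local Notation B := (Ebasis n n).
Local Notation mergesk := (merges (@simple_act n n k u)).

(** For [n = g] the nonidempotent letters are the nonzero paths in the quiver with arrows [A_i] and
    [B_i], of length one or two. The only arrow by which an arrow [p] can be multiplied on the right
    is [bar_letter p], with product [full p]. *)
Definition one_letter (b : B) := if b is bA _ then true else if b is bB _ then true else false.
Definition two_letter (b : B) := if b is bY _ then true else if b is bX _ then true else false.

Definition bar_letter (b : B) : B :=
  match b with bA i => bB n i | bB i => bA n i | _ => b end.
Definition full (b : B) : B :=
  match b with bA i => bY n i | bB i => bX n i | _ => b end.
Definition gen (b : B) : B :=
  match b with bY i => bA n i | bX i => bB n i | _ => b end.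

(** For nonidempotent [c] these [z] generate the right ideal of the elements of [e_y E] killed by
    [c] on the left, where [y = Eright c]. *)
Definition step (c z : B) : bool :=
  (Eleft z == Eright c) &&
  (if one_letter c then (z == full (bar_letter c)) || one_letter z && (z != bar_letter c)
   else two_letter c && one_letter z).

Lemma mulBA i j : Ebasis_mul (bB n i) (bA n j) = if i == j then Some (bX n i) else None.
Proof. by rewrite /= valK. Qed.

Lemma mul_one p y : one_letter p -> Ebasis_mul p y =
  if y == bE n (Eright p) then Some p
  else if y == bar_letter p then Some (full p) else None.
Proof.
case: p => // i _; case: y => [v|j|j|j|j]; rewrite ?mulBA !eq_EbasisE //=;
  by rewrite eq_sym; case: eqP => // ->.
Qed.

Lemma mul_two p y : two_letter p ->
  Ebasis_mul p y = if y == bE n (Eright p) then Some p else None.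
Proof.
by case: p => // i _; case: y => [v|j|j|j|j]; rewrite !eq_EbasisE //= eq_sym.
Qed.

Lemma mul_gen q y q' : one_letter q || two_letter q -> Ebasis_mul q y = Some q' ->
  gen q' = gen q /\ Eleft q' = Eleft q /\ (one_letter q' || two_letter q').
Proof.
case: q => // i _; case: y => [v|j|j|j|j]; rewrite ?mulBA //=;
  by case: eqP => // _ [<-].
Qed.

Lemma mul_eq_one p z y : one_letter p -> Ebasis_mul z y = Some p ->
  z = bE n (Eleft p) /\ y = p \/ z = p /\ y = bE n (Eright p).
Proof.
case: p => // i _; case: z => [v|j|j|j|j]; case: y => [w|l|l|l|l]; rewrite ?mulBA //=;
  case: eqP => // ?; move=> [] *; subst => //; try (by left); by right.
Qed.

(** Iterated syzygies give these words as indices of the projective terms in a resolution of [S_x];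
    only those ending at [u] are seen by [S_u]. The empty word accounts for [Hom(S_x, S_u)]. *)
Definition critical x r : bool :=
  if r is z :: s then
    [&& one_letter z, Eleft z == x, path step z s & Eright (last z s) == u]
  else x == u.

Definition exact_simple m := forall x (F : seq B -> k),
  (forall r, size r = m.+1 -> simple_diff u x F r = 0) ->
  (forall r, size r = m -> critical x r -> F r = 0) ->
  exists psi, forall r, size r = m -> F r = simple_diff u x psi r.

(** The module [p E] has basis [p], [full p]. The cocycle identity at [p] involves both, as [p]
    times [bar_letter p] is [full p]. *)
Definition exact_cyclic m := forall p (F : B -> seq B -> k), one_letter p ->
  (forall r, size r = m.+1 -> cyclic_diff u F p r = 0) ->
  (forall r, size r = m -> path step p r -> Eright (last p r) = u -> F p r = 0) ->
  exists psi, forall r, size r = m ->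
    F p r = cyclic_diff u psi p r /\ F (full p) r = cyclic_diff u psi (full p) r.

Definition assemble (S : pred B) (theta : B -> seq B -> k) (w : seq B) : k :=
  if w is z :: s then if S z then - theta z s else 0 else 0.

(** The letters in [S] span a right submodule of [e_x E]. Merging the first two letters of a word is
    the action on it, so an assembled cochain has differential [cyclic_diff]; the sign in [assemble]
    offsets the one created by peeling off the first letter. *)
Lemma simple_diff_assemble x (S : pred B) (theta : B -> seq B -> k) (F : seq B -> k) m :
  (forall q, S q -> (one_letter q || two_letter q) && (Eleft q == x)) ->
  (forall q y q', S q -> Ebasis_mul q y = Some q' -> S q') ->
  (forall q r, S q -> size r = m -> F (q :: r) = cyclic_diff u theta q r) ->
  forall y r, size r = m -> [|| S y, y == bE n x | Eleft y != x] ->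
    simple_diff u x (assemble S theta) (y :: r) = if S y then F (y :: r) else 0.
Proof.
move=> Sx Smul FS y r rm /orP[Sy|/orP[/eqP->|yx]].
- rewrite Sy FS //; have /andP[yl _] := Sx _ Sy.
  have ye : y == bE n x = false by case: (y) yl.
  rewrite /simple_diff ye.
  rewrite mul0r sub0r /= (_ : mergesk (assemble S theta \o cons y) r = - mergesk (theta y) r);
    last first.
    by rewrite -mergeskN; apply: eq_merges => t _; rewrite /= Sy.
  rewrite opprK; case: r rm => [|z s] rm; first by rewrite /= /simple_act mulr0 addr0 oppr0.
  rewrite /= opprD; case E: Ebasis_mul => [q|] /=.
    by rewrite (Smul _ _ _ Sy E) opprK.
  by rewrite oppr0.
- have Se : S (bE n x) = false by apply/negP => /Sx.
  rewrite Se /= eqxx mul1r merge_head_idem (@merges_cons0 _ _ _ _ (assemble S theta)) ?subr0;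
    last first.
    by move=> t; rewrite /assemble Se.
  case: eqP => [|rx]; first by rewrite mul1r subrr.
  rewrite mul0r subr0 /assemble; case: (r) rx => //= z s zx.
  by case: ifP => // /Sx /andP[_ /eqP].
have Sy : S y = false by apply/negP => /Sx /andP[_]; rewrite (negPf yx).
have ye : y == bE n x = false by apply/negP => /eqP ye; rewrite ye eqxx in yx.
rewrite Sy /= ye mul0r sub0r (@merges_cons0 _ _ _ _ (assemble S theta)) ?subr0; last first.
  by move=> t; rewrite /assemble Sy.
case: r {rm} => [|z s] /=; first by rewrite /simple_act mulr0 oppr0.
case E: Ebasis_mul => [q|] /=; last by rewrite oppr0.
by case: ifP => [/Sx /andP[_]|]; rewrite ?oppr0 // (mul_Eleft E) (negPf yx).
Qed.

(** Expand the cocycle identity on the word with [e_x] prepended. The error term lives on words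
    whose first letter starts at [x] and is not [e_x], hence lies in the radical of [e_x E]. *)
Lemma simple_diff_homotopy x (F : seq B -> k) y r : simple_diff u x F (bE n x :: y :: r) = 0 ->
  F (y :: r) = simple_diff u x (fun t => F (bE n x :: t)) (y :: r)
               + ((Eleft y == x)%:R - (y == bE n x)%:R) * F (y :: r).
Proof.
rewrite {1}/simple_diff eqxx mul1r [mergesk _ (bE n x :: _)]/= -/(mergesk _ (y :: r)).
rewrite -[oapp _ _ _]/(merge_head (@simple_act n n k u) F (bE n x) (y :: r)) merge_head_idem.
rewrite opprD opprK addrA.
set b := (X in _ + X = _) => h.
have -> : simple_diff u x (fun t => F (bE n x :: t)) (y :: r) =
  (y == bE n x)%:R * F (y :: r) - b.
  by rewrite /simple_diff; congr (_ - _); case: eqP => [ye|]; rewrite ?mul0r // ye.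
move: h; rewrite -[headv _ _]/(Eleft y) => /eqP; rewrite addr_eq0 => /eqP h.
have -> : b = - (F (y :: r) - (Eleft y == x)%:R * F (y :: r)) by rewrite h opprK.
ring.
Qed.

Lemma exact_simple0 : exact_simple 0.
Proof.
move=> x F cF critF; exists (fun=> 0) => -[] // _; rewrite [RHS]/=.
have := cF [:: bE n x] erefl; rewrite /= eqxx mul1r /simple_act subr0 ?eq_EbasisE.
by case: eqP => [/eqP xu _|]; [apply: critF | rewrite mul0r subr0].
Qed.

Lemma nonidem_gen y : one_letter y || two_letter y ->
  one_letter (gen y) /\ (y = gen y \/ y = full (gen y)) /\ Eleft (gen y) = Eleft y.
Proof. by case: y => //= i _; split=> //; split=> //; by [left | right]. Qed.

(* The radical of [e_x E] is the direct sum of the modules [p E] for the one-letter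
   [p] starting at [x]; the homotopy [r |-> F (e_x r)] reduces [F] to its values on
   words starting in that radical. *)
Lemma exact_simpleS m : exact_cyclic m -> exact_simple m.+1.
Proof.
move=> exP x F cF critF.
have /fin_all_exists[theta Htheta] (p : B) : exists psi : B -> seq B -> k,
    one_letter p && (Eleft p == x) -> forall r, size r = m ->
    F (p :: r) = cyclic_diff u psi p r /\ F (full p :: r) = cyclic_diff u psi (full p) r.
  case: (boolP (_ && _)) => [/andP[p1 /eqP px]|_]; last by exists (fun _ _ => 0).
  have [||psi psiE] := @exP p (fun q r => F (q :: r)) p1.
  - move=> [|y r] // rm; have := cF [:: p, y & r]; rewrite /= => /(_ (congr1 _ rm)).
    have pe : p == bE n x = false by case: (p) p1.
    rewrite pe.
    rewrite mul0r sub0r => /eqP; rewrite oppr_eq0 => /eqP; exact.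
  - move=> r rm pr lr; apply: critF; first by rewrite /= rm.
    by rewrite /= p1 px pr lr !eqxx.
  by exists psi.
pose S q := (one_letter q || two_letter q) && (Eleft q == x).
(* The summand [p E] of the radical has the letters [p] and [full p], both with [gen] equal to
   [p]. *)
pose th q := theta (gen q) q.
have Smul q y q' : S q -> Ebasis_mul q y = Some q' -> S q'.
  move=> /andP[q12 qx] /(mul_gen q12) [_ [ql q'12]].
  by rewrite /S q'12 ql.
have SF q r : S q -> size r = m -> F (q :: r) = cyclic_diff u th q r.
  move=> /andP[q12 /eqP qx] rm; have [g1 [qg gq]] := nonidem_gen q12.
  have := @Htheta (gen q); rewrite g1 gq qx eqxx => /(_ isT r rm) [h1 h2].
  have -> : cyclic_diff u th q r = cyclic_diff u (theta (gen q)) q r.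
    case: (r) => [|y s] //; rewrite /cyclic_diff; congr (_ - _).
    by case E: Ebasis_mul => [q'|] //=; have [<- _] := mul_gen q12 E.
  by move: (theta (gen q)) h1 h2 => th' h1 h2; case: qg => qg; [move: h1 | move: h2]; rewrite -qg.
have psiE := simple_diff_assemble (fun q Sq => Sq) Smul SF.
exists (fun t => F (bE n x :: t) + assemble S th t).
case=> [|y r] rm1 //; have rm : size r = m by case: rm1.
rewrite simple_diffD [LHS](@simple_diff_homotopy x); last first.
  by apply: cF; rewrite /= rm.
congr (_ + _); rewrite psiE //.
  rewrite /S; case: (y) => //= [v|i|i|i|i]; rewrite ?eq_EbasisE ?subr0 ?subrr ?mul0r //;
  by case: eqP; rewrite ?mul1r ?mul0r.
by rewrite /S; case: (y) => //= [v|i|i|i|i]; rewrite ?eq_EbasisE orbN.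
Qed.

(** [p E] is an extension of the simple module at [Eright p] by the simple module spanned by
    [full p]; the last summand is the connecting term. *)
Lemma cyclic_diff_one (F : B -> seq B -> k) p y s : one_letter p ->
  cyclic_diff u F p (y :: s) =
    simple_diff u (Eright p) (F p) (y :: s) + (y == bar_letter p)%:R * F (full p) s.
Proof.
move=> p1; rewrite /cyclic_diff /simple_diff mul_one // addrAC; congr (_ - _).
case: eqP => [->|_] /=.
  by rewrite mul1r; case: p p1 => //= i _; rewrite ?eq_EbasisE mul0r addr0.
by rewrite mul0r add0r; case: eqP => _ /=; rewrite ?mul1r ?mul0r.
Qed.

Lemma cyclic_diff_two (F : B -> seq B -> k) p w : two_letter p -> cyclic_diff u F p w =
  simple_diff u (Eright p) (F p) w.
Proof.
case: w => // y s p2; rewrite /cyclic_diff /simple_diff mul_two //; congr (_ - _).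
by case: eqP => _ /=; rewrite ?mul1r ?mul0r.
Qed.

(** The cocycle identity at [p], on words starting with [bar_letter p], can be solved for the value
    at [full p]. *)
Lemma full_cocycle m (F : B -> seq B -> k) p r : one_letter p ->
  (forall r, size r = m.+1 -> cyclic_diff u F p r = 0) -> size r = m ->
  F (full p) r = mergesk (F p) (bar_letter p :: r).
Proof.
move=> p1 cF rm; have := cF (bar_letter p :: r); rewrite [size _]/= rm => /(_ erefl).
rewrite cyclic_diff_one // eqxx mul1r /simple_diff.
have pe : bar_letter p == bE n (Eright p) = false by case: (p) p1.
by rewrite pe mul0r sub0r addrC => /eqP; rewrite subr_eq0 => /eqP.
Qed.

Lemma exact_cyclic0 : exact_cyclic 0.
Proof.
move=> p F p1 cF critF; exists (fun _ _ => 0) => -[] // _; split; rewrite [RHS]/=.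
  have pe : bE n (Eright p) == bar_letter p = false by case: (p) p1.
  have := cF [:: bE n (Eright p)] erefl.
  rewrite cyclic_diff_one // pe mul0r addr0 /= eqxx mul1r /simple_act subr0 eq_EbasisE;
    case: eqP => [pu _|]; last by rewrite mul0r subr0.
  exact: critF.
rewrite (full_cocycle p1 cF) //= /simple_act.
have -> : bar_letter p == bE n u = false by case: (p) p1.
by rewrite mul0r subr0.
Qed.

(* With [y = Eright p] and [p' = bar_letter p], the kernel of [e_y E -> p E] is the
   direct sum of the simple module spanned by [p' p] and of the modules [q E] for
   the one-letter [q <> p'] starting at [y].  The homotopy reduces [F] to its values
   on words starting in that kernel. *)
Lemma exact_cyclicS m : exact_simple m -> exact_cyclic m -> exact_cyclic m.+1.
Proof.
move=> exN exP p F p1 cF critF.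
set y0 := Eright p; set p' := bar_letter p; set t := full p'.
have [t2 [Lt Rt]] : two_letter t /\ Eleft t = y0 /\ Eright t = y0.
  by rewrite /t /y0 /p'; case: (p) p1.
have mul_pt : Ebasis_mul p t = None.
  rewrite mul_one //; have -> : t == bE n (Eright p) = false by case: (t) t2.
  by rewrite /t /p'; case: (p) p1.
have tail_cocycle q r : (forall v, q != bE n v) -> Ebasis_mul p q = None -> size r = m.+1 ->
    cyclic_diff u (fun q r => F p (q :: r)) q r = 0.
  move=> qe pq rm; have := cF (q :: r); rewrite [size _]/= rm => /(_ erefl).
  rewrite /cyclic_diff pq /= sub0r => /eqP; rewrite oppr_eq0; case: r rm => // y s _ /eqP.
  exact.
have [psit psitE] : exists psi, forall r, size r = m -> F p (t :: r) = simple_diff u y0 psi r.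
  apply: exN => r rm.
    have := tail_cocycle t r; rewrite cyclic_diff_two // Rt; apply=> //.
    by case: (t) t2.
  move=> cr; apply: critF; rewrite /= ?rm //.
    have -> : step p t by rewrite /step Lt p1 /t /p' !eqxx.
    case: (r) cr => //= z s /and4P[z1 /eqP zy -> _].
    by rewrite /step zy Rt z1 t2 eqxx /= /t /p'; case: (p) p1.
  case: (r) cr => [|z s]; first by move/eqP; rewrite /= Rt.
  by case/and4P=> _ _ _ /eqP.
(* The letters in [S] form a basis of the kernel of [e_y E -> p E] for [y = y0]. *)
pose S q := [&& one_letter q || two_letter q, Eleft q == y0 & q != p'].
have /fin_all_exists[theta Htheta] (q : B) : exists psi : B -> seq B -> k,
    one_letter q && S q -> forall r, size r = m ->
    F p (q :: r) = cyclic_diff u psi q r /\ F p (full q :: r) = cyclic_diff u psi (full q) r.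
  case: (boolP (_ && _)) => [|_]; last by exists (fun _ _ => 0).
  move=> /and4P[q1 _ /eqP qx qp'].
  have pq : Ebasis_mul p q = None.
    by rewrite mul_one // (negPf qp'); case: (q) q1 => // j _.
  have [||psi psiE] := @exP q (fun q r => F p (q :: r)) q1.
  - by move=> r rm; apply: tail_cocycle => //; case: (q) q1.
  - move=> r rm pr lr; apply: critF => //; first by rewrite /= rm.
    by rewrite /= pr /step qx p1 q1 qp' eqxx orbT.
  by exists psi.
pose th q := if q == t then psit else theta (gen q) q.
have SS q : S q -> (one_letter q || two_letter q) && (Eleft q == y0).
  by case/and3P=> -> ->.
have gent : gen t = p' by rewrite /t /p'; case: (p) p1.
have genS q : S q -> q != t -> gen q != p'.
  case/and3P => q12 _ qp' qt; have [_ [[<-//|qg] _]] := nonidem_gen q12.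
  by apply: contra_neq qt; rewrite {2}qg => ->.
have Smul q y q' : S q -> Ebasis_mul q y = Some q' -> S q'.
  move=> Sq E; have /and3P[q12 qx qp'] := Sq.
  have [gq [ql q'12]] := mul_gen q12 E; rewrite /S q'12 ql qx /=.
  case: (eqVneq q t) => [qt|/(genS _ Sq)]; last first.
    rewrite -gq; apply: contra_neq => ->.
    by rewrite /p'; case: (p) p1.
  by move: E; rewrite qt mul_two //; case: eqP => // _ [<-]; rewrite -qt.
have SF q r : S q -> size r = m -> F p (q :: r) = cyclic_diff u th q r.
  move=> Sq rm; have /and3P[q12 /eqP qx qp'] := Sq.
  case: (eqVneq q t) => [->|qt].
    by rewrite psitE // cyclic_diff_two // Rt /th eqxx.
  have [g1 [qg gq]] := nonidem_gen q12.
  have := @Htheta (gen q); rewrite g1 /S g1 gq qx eqxx (genS _ Sq qt) => /(_ isT r rm) [h1 h2].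
  have -> : cyclic_diff u th q r = cyclic_diff u (theta (gen q)) q r.
    case: (r) => [|y s] //; rewrite /cyclic_diff /th (negPf qt); congr (_ - _).
    case E: Ebasis_mul => [q'|] //=; have [gq' _] := mul_gen q12 E.
    case: eqP => [qt'|_]; last by rewrite gq'.
    by move: (genS _ Sq qt); rewrite -gq' qt' gent eqxx.
  by move: (theta (gen q)) h1 h2 => th' h1 h2; case: qg => qg; [move: h1 | move: h2]; rewrite -qg.
(* Since [p' p = t], a word starting with [p'], [p] merges to one starting with [t]. The value
   [- psit] at [full p] cancels that contribution. *)
pose psif w := if w is z :: s then if z == p then - psit s else 0 else 0.
have fullp : full p == p = false by case: (p) p1.
have psiE := simple_diff_assemble SS Smul SF.
(* At [p] this is the homotopy by [e_y] ([y = y0]) plus the assembled cochain; at [full p],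
   prepending [p'] follows the formula of [full_cocycle]. *)
exists (fun q w => (if q == p then F p (bE n y0 :: w) else F p (p' :: w))
   + (if q == p then assemble S th w else psif w)).
case=> [|y r] rm1 //; have rm : size r = m by case: rm1.
split; rewrite cyclic_diffD.
  rewrite !cyclic_diff_one //; cbv beta; rewrite !eqxx !fullp -/y0 -/p'.
  rewrite [LHS](@simple_diff_homotopy y0); last first.
    have := cF (bE n y0 :: y :: r); rewrite [size _]/= rm => /(_ erefl).
    rewrite cyclic_diff_one //.
    have -> : bE n y0 == bar_letter p = false by case: (p) p1.
    by rewrite mul0r addr0.
  set d0 := simple_diff u y0 _ _; rewrite -(addrA d0); congr (d0 + _) => {d0}.
  case: (eqVneq y p') => [->|yp'].
    have p'e : p' == bE n y0 = false by rewrite /p'; case: (p) p1.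
    have Sp' : S p' = false by rewrite /S eqxx !andbF.
    rewrite /simple_diff p'e /= (@merges_cons0 _ _ _ _ (assemble S th)) ?subr0; last first.
      by move=> s; rewrite /assemble Sp'.
    have p'1 : one_letter p' by rewrite /p'; case: (p) p1.
    have p'y : Eleft p' = y0 by rewrite /p' /y0; case: (p) p1.
    rewrite p'y eqxx !mul1r mul0r sub0r -[LHS]addr0; congr (_ + _).
    case: (r) => [|z s] /=; first by rewrite /simple_act mulr0 oppr0 addr0.
    rewrite mul_one //; have [-> zp] : bar_letter p' = p /\ p == bE n (Eright p') = false.
      by rewrite /p'; case: (p) p1.
    case: (eqVneq z p) => [->|_]; last first.
      by case: ifP => _; rewrite /= ?Sp' oppr0 addr0.
    rewrite zp /= -/t (_ : S t); last by rewrite /S Lt t2 eqxx orbT;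
      case: (t) t2 (p') p'1 => // j _ [].
    by rewrite /th eqxx opprK addrN.
  rewrite !mul0r add0r addr0 psiE //; last first.
    by rewrite /S yp' andbT; case: (y) => //= [v|i|i|i|i]; rewrite ?eq_EbasisE ?orbN.
  rewrite /S yp' andbT; case: (y) => //= [v|i|i|i|i]; rewrite ?eq_EbasisE ?subr0 ?subrr ?mul0r //;
  by case: eqP; rewrite ?mul1r ?mul0r.
rewrite !cyclic_diff_two; [|by case: (p) p1..]; cbv beta; rewrite !fullp.
have -> : Eright (full p) = Eleft p by case: (p) p1.
set x' := Eleft p.
rewrite (full_cocycle p1 cF) // -/p'.
have pf0 : Eleft p = x' by [].
have -> : mergesk (F p) (p' :: y :: r) =
    simple_diff u x' (fun w => F p (p' :: w)) (y :: r) + (y == p)%:R * F p (t :: r).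
  rewrite /simple_diff [mergesk _ (p' :: _)]merges_cons addrAC; congr (_ - _).
  rewrite /= mul_one; last by rewrite /p'; case: (p) p1.
  have [-> ->] : bar_letter p' = p /\ Eright p' = x' by rewrite /p' /x'; case: (p) p1.
  case: (eqVneq y (bE n x')) => [->|_] /=.
    have -> : bE n x' == p = false by case: (p) p1.
    by rewrite mul1r mul0r addr0.
  by case: eqP => _ /=; rewrite ?mul1r ?mul0r add0r.
congr (_ + _).
case: (eqVneq y p) => [->|yp].
  have pe : p == bE n x' = false by case: (p) p1.
  rewrite mul1r psitE // /simple_diff pe mul0r sub0r.
  rewrite merges_cons.
  rewrite (_ : mergesk (psif \o cons p) r = - mergesk psit r); last first.
    by rewrite -mergeskN; apply: eq_merges => s _; rewrite /psif /= eqxx.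
  case: r {rm rm1} => [|z s]; first by rewrite /= /simple_act mulr0 !(oppr0, subr0).
  rewrite [RHS]opprB [RHS]addrC; congr (_ - _); rewrite [merge_head _ _ _ _]/= mul_one //.
  rewrite -/y0; case: ifP => _ /=.
    by rewrite eqxx mul1r opprK.
  by rewrite mul0r; case: eqP => _ /=; rewrite ?fullp oppr0.
rewrite mul0r.
case: (eqVneq y (bE n x')) => [->|ye].
  rewrite /simple_diff eqxx mul1r merges_cons merge_head_idem merges_cons0; last first.
    have xp : bE n x' == p = false by case: (p) p1.
    by move=> s; rewrite /psif xp.
  rewrite subr0; case: (eqVneq (headv u r) x') => [|rx]; first by rewrite mul1r subrr.
  rewrite mul0r subr0 /psif; case: (r) rx => // z s zx; case: (eqVneq z p) zx => // ->.
  by rewrite /= pf0 eqxx.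
rewrite /simple_diff (negPf ye) mul0r sub0r merges_cons merges_cons0 ?subr0; last first.
  by move=> s; rewrite /psif (negPf yp).
case: (r) => [|z s] /=; first by rewrite /simple_act mulr0 oppr0.
case E: Ebasis_mul => [q|] /=; last by rewrite oppr0.
case: eqP => [qp|_]; last by rewrite oppr0.
move: E; rewrite qp => /(mul_eq_one p1) [[yE _]|[yE _]].
  by rewrite yE eqxx in ye.
by rewrite yE eqxx in yp.
Qed.

Lemma simple_exactness m : exact_simple m.
Proof.
suff [] : exact_simple m /\ exact_cyclic m by [].
elim: m => [|m [exN exP]]; first by split; [apply: exact_simple0 | apply: exact_cyclic0].
by split; [apply: exact_simpleS | apply: exact_cyclicS].
Qed.

End Exactness.

(** * Multilinearity of the Hochschild differential *)

Section Multilinear.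
Variables (k : fieldType) (A : falgType k).

Lemma multilinear0 i (f : {ffun 'I_i -> A} -> A) s (a : {ffun 'I_i -> A}) :
  multilinear f -> a s = 0 -> f a = 0.
Proof.
move=> fl as0; have := fl s a (-1) 0 0; rewrite scaler0 addr0 scaleN1r addNr.
suff -> : upd a s 0 = a by [].
by apply/ffunP => t; rewrite ffunE; case: eqP => // ->.
Qed.

Lemma multilinearD i (f h : {ffun 'I_i -> A} -> A) :
  multilinear f -> multilinear h -> multilinear (fun a => f a + h a).
Proof. by move=> fl hl s a c x y; rewrite fl hl scalerDr addrACA. Qed.

Lemma multilinearZ i (f : {ffun 'I_i -> A} -> A) (z : k) :
  multilinear f -> multilinear (fun a => z *: f a).
Proof. by move=> fl s a c x y; rewrite fl scalerDr !scalerA mulrC. Qed.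

Lemma multilinear_sum i m (f : 'I_m -> {ffun 'I_i -> A} -> A) :
  (forall t, multilinear (f t)) -> multilinear (fun a => \sum_t f t a).
Proof.
move=> fl s a c x y; rewrite scaler_sumr -big_split /=.
by apply: eq_bigr => t _; apply: fl.
Qed.

Lemma hochschild_diff_multilinear i j (f : {ffun 'I_i -> A} -> A) d :
  multilinear f -> multilinear (hochschild_diff j f d).
Proof.
move=> fl; rewrite /hochschild_diff.
apply: multilinearD; first apply: multilinearD.
- apply: multilinearZ => s a c x y.
  case: (unliftP ord0 s) => [s'|] ->.
    have E z : [ffun s0 => upd a (lift ord0 s') z (lift ord0 s0)]
       = upd [ffun s0 => a (lift ord0 s0)] s' z.
      by apply/ffunP => t; rewrite !ffunE (inj_eq lift_inj).
    by rewrite !E fl !ffunE /= mulrDr scalerAr.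
  have E z : [ffun s0 => upd a ord0 z (lift ord0 s0)] = [ffun s0 : 'I_i => a (lift ord0 s0)].
    by apply/ffunP => t; rewrite !ffunE.
  by rewrite !E !ffunE eqxx mulrDl scalerAl.
- apply: multilinear_sum => t; apply: multilinearZ => s a c x y.
  (* Changing slot [s] changes a single slot of the merged tuple, linearly: [F] is the identity, or
     multiplication by the neighbour when [s] is [t] or [t.+1]. *)
  have [s' [F [Fl E]]] : exists s' : 'I_i, exists F : A -> A,
      (forall c x y, F (c *: x + y) = c *: F x + F y) /\
      forall z, Defs.merge t (upd a s z) = upd (Defs.merge t a) s' (F z).
    have lm (r : 'I_i) : (lift ord_max r == s) = (r == s :> nat).
      by rewrite -(inj_eq (@ord_inj _)) lift_max.
    have l0 (r : 'I_i) : (lift ord0 r == s) = (r.+1 == s :> nat).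
      by rewrite -(inj_eq (@ord_inj _)) lift0.
    case: (ltnP s t) => st.
      have si : (s < i)%N by apply: ltn_trans st _.
      exists (Ordinal si), id; split=> // z; apply/ffunP => r.
      rewrite !ffunE lm l0 -!val_eqE /=.
      by case: (ltngtP r t) => rt; repeat (case: eqP => ? //); lia.
    case: (eqVneq (s : nat) t) => [st2|st2].
      exists t, (fun z => z * a (lift ord0 t)); split=> [c1 x1 y1|z].
        by rewrite mulrDl scalerAl.
      apply/ffunP => r; rewrite !ffunE lm l0 -!val_eqE /= st2.
      case: (ltngtP r t) => [rt|rt|/val_inj->]; last by case: eqP => // ?; lia.
        by [].
      by case: eqP => //; lia.
    have s0 : (s.-1 < i)%N by case: (s) st st2 => [[|m] /=]; lia.
    case: (eqVneq (s : nat) t.+1) => [st3|st3].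
      exists t, (fun z => a (lift ord_max t) * z); split=> [c1 x1 y1|z].
        by rewrite mulrDr scalerAr.
      apply/ffunP => r; rewrite !ffunE lm l0 -!val_eqE /= st3.
      case: (ltngtP r t) => [rt|rt|/val_inj->]; last by rewrite eqxx; case: eqP => // ?; lia.
        by case: eqP => //; lia.
      by case: eqP => //; lia.
    exists (Ordinal s0), id; split=> // z; apply/ffunP => r.
    rewrite !ffunE lm l0 -!val_eqE /=.
    by case: (ltngtP r t) => rt; repeat (case: eqP => ? //); lia.
  by rewrite !E Fl fl.
apply: multilinearZ => s a c x y.
case: (unliftP ord_max s) => [s'|] ->.
  have E z : [ffun s0 => upd a (lift ord_max s') z (lift ord_max s0)]
     = upd [ffun s0 => a (lift ord_max s0)] s' z.
    by apply/ffunP => t; rewrite !ffunE (inj_eq lift_inj).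
  by rewrite !E fl !ffunE /= (negPf (neq_lift _ _)) mulrDl scalerAl.
have E' z : [ffun s0 : 'I_i => upd a ord_max z (lift ord_max s0)] = [ffun s0 :
    'I_i => a (lift ord_max s0)].
  by apply/ffunP => t; rewrite !ffunE eq_sym (negPf (neq_lift _ _)).
by rewrite !E' !ffunE eqxx mulrDr scalerAr.
Qed.

End Multilinear.

(** * From multilinear cochains to functions on words *)

Section Bridge.
Variables (k : fieldType) (g n : nat).
Local Notation B := (Ebasis g n).
Local Notation E := (Egn k g n).
Local Notation b0 := (bE g (None : option 'I_n)).
Implicit Types (F : seq B -> E) (w r : seq B).

Lemma Evec_mul (b c : B) : Evec k b * Evec k c = oapp (@Evec k g n) 0 (Ebasis_mul b c).
Proof. exact: Emul_vec. Qed.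

Definition right_act (y : E) (b : B) : E := y * Evec k b.
Definition koszul (j : int) (b : B) : k := (-1) ^ (j * (Edeg b)%:Z).

Definition word_diff j F w : E :=
  if w is x :: r then koszul j x *: (Evec k x * F r) - merges right_act F w else 0.

Definition merge_at t F w : E :=
  oapp (fun z => F (take t w ++ z :: drop t.+2 w)) 0
    (Ebasis_mul (nth b0 w t) (nth b0 w t.+1)).

Lemma merges_sum i F w : size w = i.+1 -> merges right_act F w =
  \sum_(t < i) (-1 : k) ^+ t *: merge_at t F w + (-1 :
    k) ^+ i *: right_act (F (take i w)) (nth b0 w i).
Proof.
elim: i F w => [|i IH] F [|x [|y s]] //= sw.
  by rewrite big_ord0 add0r scale1r subr0.
have -> : (merge_head right_act (F \o cons x) y s - merges right_act ((F \o cons x) \o cons y) s)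
   = merges right_act (F \o cons x) (y :: s) by [].
have sw' : size (y :: s) = i.+1 by case: sw => <-.
rewrite (IH _ _ sw') /= big_ord_recl /= expr0 scale1r /merge_at /= drop0.
rewrite opprD addrA; congr (_ + _ + _); last by rewrite exprS mulN1r scaleNr.
rewrite -sumrN; apply: eq_bigr => t _; rewrite /bump leq0n add1n exprS mulN1r scaleNr.
by [].
Qed.

Definition vecs i w : {ffun 'I_i -> E} := [ffun s : 'I_i => Evec k (nth b0 w s)].
Definition degs i w : 'I_i -> int := fun s => (Edeg (nth b0 w s))%:Z.
Definition onwords i (f : {ffun 'I_i -> E} -> E) w := f (vecs i w).

Lemma diff_words i j (f : {ffun 'I_i -> E} -> E) w : multilinear f -> size w = i.+1 ->
  hochschild_diff j f (@degs i.+1 w) (vecs i.+1 w) = word_diff j (onwords f) w.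
Proof.
move=> fl; case: w => // x r [ri].
rewrite /word_diff (@merges_sum i) /= ?ri // opprD addrA /hochschild_diff; congr (_ + _ + _).
- rewrite ffunE /= /koszul /onwords; congr (_ *: (_ * f _)).
  by apply/ffunP => s; rewrite !ffunE.
- rewrite -sumrN; apply: eq_bigr => t _; rewrite exprS mulN1r scaleNr; congr (- (_ *: _)).
  rewrite /merge_at /onwords; case Em: Ebasis_mul => [z|] /=.
    congr f; apply/ffunP => s; rewrite !ffunE lift_max lift0 /=.
    have ti : size (take t (x :: r)) = t.
      by rewrite size_takel //= ri ltnW // ltnS ltnW.
    rewrite nth_cat ti; case: ltngtP => [st|st|/val_inj st].
    - by rewrite nth_take.
    - have -> : (s - t = (s - t.+1).+1)%N by lia.
      by rewrite /= nth_drop subnKC //; case: eqP st => // ->; rewrite ltnn.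
    - by rewrite st eqxx subnn /= Evec_mul Em.
  apply: (multilinear0 (s := t)) => //; rewrite !ffunE ltnn eqxx lift_max lift0 /=.
  by rewrite Evec_mul Em.
rewrite exprS mulN1r scaleNr; congr (- (_ *: (f _ * _))).
  apply/ffunP => s; rewrite !ffunE lift_max nth_take //.
by rewrite ffunE.
Qed.

Lemma Egr_coord d (x : E) b : x \in Egr k g n d -> (Edeg b)%:Z != d -> x b = 0.
Proof.
move=> /coord_span -> bd; rewrite sum_ffunE big1 // => s _; rewrite ffunE.
have /imageP[c cd ->] :
    [seq Evec k c | c in [pred c : B | (Edeg c)%:Z == d]]`_s
      \in [seq Evec k c | c in [pred c : B | (Edeg c)%:Z == d]] by rewrite mem_nth ?size_image.
move: cd; rewrite inE => /eqP cd; rewrite ffunE; case: eqP => [bc|_]; last by rewrite scaler0.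
by rewrite bc cd eqxx in bd.
Qed.

Lemma mem_Egr d (x : E) : (forall b, x b != 0 -> (Edeg b)%:Z = d) -> x \in Egr k g n d.
Proof.
move=> xd; rewrite [x]Evec_sum memv_suml // => b _.
case: (eqVneq (x b) 0) => [->|/xd <-]; first by rewrite scale0r mem0v.
by rewrite memvZ // Egr_vec.
Qed.

(** Slots are expanded in the basis one at a time; in the induction, [m] bounds the initial slots
    that are still arbitrary. A homogeneous argument involves only basis elements of its own degree,
    so [d] remains the degree of the letters. *)
Lemma multilinear_ext i (G : {ffun 'I_i -> E} -> E) (d : 'I_i -> int) : multilinear G ->
  (forall w : 'I_i -> B, (forall s, (Edeg (w s))%:Z = d s) ->
     G [ffun s => Evec k (w s)] = 0) ->
  forall a, homogeneous_args (Egr k g n) d a -> G a = 0.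
Proof.
move=> Gl Gw.
suff H m (w : 'I_i -> B) (a : {ffun 'I_i -> E}) : (forall s : 'I_i, (m <= s)%N -> a s =
  Evec k (w s) /\ (Edeg (w s))%:Z = d s) ->
    homogeneous_args (Egr k g n) d a -> G a = 0.
  by move=> a; apply: (H i (fun=> b0)) => s; rewrite leqNgt ltn_ord.
elim: m w a => [|m IH] w a aw ha.
  have -> : a = [ffun s => Evec k (w s)] by apply/ffunP => s; rewrite ffunE; case: (aw s).
  by apply: Gw => s; case: (aw s).
case: (ltnP m i) => mi; last first.
  by apply: (IH w) => // s ms; have := leq_trans mi ms; rewrite leqNgt ltn_ord.
pose s := Ordinal mi.
have Gsum (I : seq B) (F : B -> E) (c : B -> k) :
    G (upd a s (\sum_(b <- I) c b *: F b)) = \sum_(b <- I) c b *: G (upd a s (F b)).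
  elim: I => [|b I IHI]; last by rewrite !big_cons Gl IHI.
  by rewrite !big_nil; apply: (multilinear0 (s := s)) => //; rewrite ffunE eqxx.
have -> : a = upd a s (\sum_b a s b *: Evec k b).
  by apply/ffunP => t; rewrite ffunE -Evec_sum; case: eqP => // ->.
rewrite Gsum big1 // => b _.
case: (eqVneq (Edeg b)%:Z (d s)) => [bd|bd]; last by rewrite (Egr_coord (ha s) bd) scale0r.
rewrite (IH (fun t => if t == s then b else w t)) ?scaler0 //.
  move=> t mt; rewrite ffunE; case: (eqVneq t s) => [->//|ts]; apply: aw.
  by rewrite ltn_neqAle mt andbT; apply: contra_neq ts => mt'; apply: val_inj.
by move=> t; rewrite ffunE; case: eqP => // ->; rewrite -bd Egr_vec.
Qed.

Definition wdeg w : int := (sumn [seq Edeg b | b <- w])%:Z.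

Arguments wdeg : simpl never.

Definition homog_words i j F :=
  forall w, size w = i -> forall c, F w c != 0 -> (Edeg c)%:Z = wdeg w + j.

(** The multilinear extension of a function on words. *)
Definition of_words i F (a : {ffun 'I_i -> E}) : E :=
  \sum_(w : {ffun 'I_i -> B}) (\prod_s a s (w s)) *: F [seq w s | s <- enum 'I_i].

Lemma of_words_multilinear i F : multilinear (@of_words i F).
Proof.
move=> s a c x y; rewrite /of_words scaler_sumr -big_split /=.
apply: eq_bigr => w _; rewrite scalerA -scalerDl; congr (_ *: _).
have prodE (z : E) : \prod_t upd a s z t (w t) = z (w s) * \prod_(t | t != s) a t (w t).
  rewrite (bigD1 s) //= ffunE eqxx; congr (_ * _).
  by apply: eq_bigr => t ts; rewrite ffunE (negPf ts).
by rewrite !prodE !ffunE mulrDl mulrA.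
Qed.

Lemma onwords_of_words i F w : size w = i -> onwords (@of_words i F) w = F w.
Proof.
move=> wi; rewrite /onwords /of_words (bigD1 [ffun s : 'I_i => nth b0 w s]) //=.
rewrite [X in _ + X]big1 => [|w' ww']; last first.
  suff [s ws] : exists s, w' s != nth b0 w s.
    by rewrite (bigD1 s) //= !ffunE (negPf ws) mul0r scale0r.
  apply/existsP; apply: contraNT ww' => /existsPn ww'; apply/eqP/ffunP => s.
  by rewrite ffunE; apply/eqP/negPn.
rewrite addr0 big1 ?scale1r => [|s _]; last by rewrite !ffunE eqxx.
congr (F _); rewrite -[RHS]take_size wi -(@map_nth_iota0 _ b0) ?wi // -val_enum_ord -map_comp.
by apply: eq_map => s /=; rewrite ffunE.
Qed.

Lemma of_words_homogeneous i j F : homog_words i j F ->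
  homogeneous_map (Egr k g n) j (@of_words i F).
Proof.
move=> hF d a ha; rewrite memv_suml // => w _.
case: (eqVneq (\prod_s a s (w s)) 0) => [->|aw]; first by rewrite scale0r mem0v.
apply: memvZ; apply: mem_Egr => c Fc; rewrite (hF _ _ _ Fc); last by rewrite size_map size_enum_ord.
congr (_ + _); rewrite /wdeg -map_comp sumnE big_map big_enum /= (big_morph Posz PoszD erefl).
apply: eq_bigr => s _; apply/eqP; apply: contraNT aw => ds.
by rewrite (bigD1 s) //= (Egr_coord (ha s) ds) mul0r.
Qed.

Definition cobound_words i j := forall F, homog_words i.+1 j F ->
  (forall w, size w = i.+2 -> word_diff j F w = 0) ->
  exists2 H, homog_words i j H & forall w, size w = i.+1 -> F w = word_diff j H w.

Lemma onwords_homog i j (f : {ffun 'I_i -> E} -> E) : homogeneous_map (Egr k g n) j f ->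
  homog_words i j (onwords f).
Proof.
move=> fh w wi c; apply: contra_neq_eq => cd.
have wE : wdeg w = \sum_s @degs i w s.
  rewrite /wdeg sumnE big_map (big_nth b0) wi big_mkord (big_morph Posz PoszD erefl).
  by apply: eq_bigr.
rewrite wE in cd; apply: Egr_coord cd; apply: fh => s; rewrite ffunE; exact: Egr_vec.
Qed.

Lemma degs_vecs i w : homogeneous_args (Egr k g n) (@degs i w) (vecs i w).
Proof. by move=> s; rewrite ffunE Egr_vec. Qed.

Lemma eq_word_diff j F H w : (forall t, (size t).+1 = size w -> F t = H t) -> word_diff j F w =
  word_diff j H w.
Proof.
case: w => // x r FH; rewrite /word_diff (eq_merges _ FH); congr (_ *: (_ * _) - _).
exact: FH.
Qed.

Lemma of_words_diff i j F d a : homogeneous_args (Egr k g n) d a ->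
  forall G : {ffun 'I_i.+1 -> E} -> E, multilinear G ->
  (forall w, size w = i.+1 -> onwords G w = word_diff j F w) ->
  G a = hochschild_diff j (@of_words i F) d a.
Proof.
move=> ha G Gl GF; apply/eqP; rewrite -subr_eq0; apply/eqP.
pose D := fun a => G a + (-1) *: hochschild_diff j (@of_words i F) d a.
rewrite -scaleN1r -[LHS]/(D a); apply: multilinear_ext ha.
  apply: multilinearD => //; apply/multilinearZ/hochschild_diff_multilinear/of_words_multilinear.
move=> w wd; pose ws := [seq w s | s <- enum 'I_i.+1].
have sws : size ws = i.+1 by rewrite size_map size_enum_ord.
have nth_ws (s : 'I_i.+1) : nth b0 ws s = w s.
  by rewrite (nth_map ord0) ?size_enum_ord // nth_ord_enum.
have wE : [ffun s => Evec k (w s)] = vecs i.+1 ws.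
  by apply/ffunP => s; rewrite !ffunE nth_ws.
rewrite /D wE -[G _]/(onwords G ws) GF //.
(* The differential depends on [d] only through the Koszul sign of the first argument. *)
have -> : hochschild_diff j (@of_words i F) d (vecs i.+1 ws)
   = hochschild_diff j (@of_words i F) (@degs i.+1 ws) (vecs i.+1 ws).
  by rewrite /hochschild_diff -(wd ord0) /degs nth_ws.
rewrite diff_words //; last exact: of_words_multilinear.
rewrite scaleN1r; apply/eqP; rewrite subr_eq0; apply/eqP; apply: eq_word_diff => t.
by rewrite sws => -[ti]; rewrite onwords_of_words.
Qed.

Lemma HH_eq0_words i j : HH_eq0 (Egr k g n) i.+1 j <-> cobound_words i j.
Proof.
split=> [HH F hF cF|cob f [[fl fh] fc]].
  have [|b [[bl bh] bE]] := HH (@of_words i.+1 F).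
    split; first by split; [apply: of_words_multilinear | apply: of_words_homogeneous].
    move=> d a ha; rewrite -(of_words_diff (F := F) (j := j) ha (G := fun=> 0)) //
      => [s a' c x y|w wi].
      by rewrite scaler0 addr0.
    by rewrite cF.
  exists (onwords b); first exact: onwords_homog.
  move=> w wi; rewrite -(onwords_of_words F wi) -diff_words //.
  by rewrite /onwords (bE _ _ (@degs_vecs i.+1 w)).
have [||H hH HE] := cob (onwords f).
- exact: onwords_homog.
- by move=> w wi; rewrite -diff_words // fc //; apply: degs_vecs.
exists (@of_words i H); split.
  by split; [apply: of_words_multilinear | apply: of_words_homogeneous].
by move=> d a ha; apply: of_words_diff.
Qed.

End Bridge.

(** * The merging operator squares to zero *)

Section Square.
Variables (g n : nat) (V : zmodType) (e : V -> Ebasis g n -> V).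
Local Notation B := (Ebasis g n).
Hypothesis eD : forall b, {morph e^~ b : y z / y + z}.
Hypothesis eM : forall y b c, e (e y b) c = oapp (e y) 0 (Ebasis_mul b c).

(** Merging [x] into its successor commutes with the later merges. The case where the two merges
    overlap is associativity, which at the end of the word takes the form [eM]. *)
Lemma merges_merge_head F x r : merge_head e (merges e F) x r = merges e (merge_head e F x) r.
Proof.
case: r => [|y s]; first by rewrite /= (act0 eD).
rewrite merges_cons.
have -> : merge_head e (merge_head e F x) y s =
    oapp (fun z => merge_head e F z s) 0 (Ebasis_mul x y).
  case: s => [|y' s'] /=; first exact: eM.
  have := Ebasis_mulA x y y'; case: (Ebasis_mul x y) => [z|] /=;
    case: (Ebasis_mul y y') => [z'|] //=; by [move=> -> | move=> <-].
have -> : merge_head e F x \o cons y = fun t => oapp (fun z => F (z :: t)) 0 (Ebasis_mul x y) by [].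
rewrite [LHS]/=; case: (Ebasis_mul x y) => [z|] //.
by rewrite merges0 ?subr0 // => b; apply: (act0 eD).
Qed.

Lemma merges_merges F w : merges e (merges e F) w = 0.
Proof.
elim: w F => // x r IH F; rewrite merges_cons merges_merge_head.
have -> : merges e (merges e F \o cons x) r =
   merges e (merge_head e F x) r - merges e (merges e (F \o cons x)) r.
  by rewrite -(mergesN eD) -(mergesD eD).
by rewrite IH subr0 subrr.
Qed.

End Square.

(** * Coordinates of the differential, rank and degree *)

Section Algebra.
Variables (k : fieldType) (g n : nat).
Local Notation B := (Ebasis g n).
Local Notation E := (Egn k g n).
Implicit Types (F H : seq B -> E) (w r : seq B).

Lemma right_actD b : {morph (@right_act k g n)^~ b : y z / y + z}.
Proof. by move=> y z; rewrite /right_act mulrDl. Qed.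

Lemma right_actM y b c : right_act (right_act y b) c = oapp (@right_act k g n y) 0 (Ebasis_mul b c).
Proof.
by rewrite /right_act -mulrA Evec_mul; case: Ebasis_mul => //=; rewrite mulr0.
Qed.

Lemma Edeg_mul (x y z : B) : Ebasis_mul x y = Some z -> Edeg z = (Edeg x + Edeg y)%N.
Proof.
case: x => [v|i|i|i|i]; case: y => [w|l|l|l|l] //=; case: ifP => // _; try by case=> <-.
by case: insub => //= ? [<-].
Qed.

Lemma koszul_mul j (x y z : B) : Ebasis_mul x y = Some z -> koszul k j z =
  koszul k j x * koszul k j y.
Proof.
move=> /Edeg_mul zE; rewrite /koszul zE PoszD mulrDr expfzDr //.
by rewrite oppr_eq0 oner_eq0.
Qed.

Lemma merges_mull j x F w :
  merges (@right_act k g n) (fun t => koszul k j x *: (Evec k x * F t)) w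
    = koszul k j x *: (Evec k x * merges (@right_act k g n) F w).
Proof.
elim: w F => [|y r IH] F; first by rewrite /= mulr0 scaler0.
rewrite !merges_cons mulrBr scalerBr; congr (_ - _); last exact: IH.
case: r {IH} => [|z s] /=; first by rewrite /right_act -scalerAl mulrA.
by case: Ebasis_mul => //=; rewrite mulr0 scaler0.
Qed.

(** The double merges cancel by [merges_merges]; the terms with left multiplication cancel by
    associativity and multiplicativity of the Koszul sign. *)
Lemma word_diff_word_diff j F w : word_diff j (word_diff j F) w = 0.
Proof.
case: w => // x r; rewrite {1}/word_diff.
pose L w := if w is x :: r then koszul k j x *: (Evec k x * F r) else 0.
have dEL w : word_diff j F w = L w - merges (@right_act k g n) F w by case: w => //=; rewrite subr0.
have -> : merges (@right_act k g n) (word_diff j F) (x :: r) = merges (@right_act k g n) L (x :: r).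
  rewrite (@eq_merges g n _ _ _ (fun t => L t + (- merges (@right_act k g n) F t)));
    last by move=> t _.
  rewrite (mergesD right_actD) (mergesN right_actD) merges_merges ?subr0 //;
    [exact: right_actD | exact: right_actM].
rewrite merges_cons (merges_mull j x) dEL mulrBr scalerBr opprB addrA addrNK.
apply/eqP; rewrite subr_eq0; apply/eqP.
case: r => [|y s] /=; first by rewrite /right_act mul0r mulr0 scaler0.
rewrite -scalerAr scalerA mulrA Evec_mul.
case Exy: Ebasis_mul => [z|] /=; last by rewrite mul0r scaler0.
by rewrite (koszul_mul _ Exy).
Qed.

(** Basis letters are cancellable: at most one letter [b] satisfies [x b = c]. A coordinate of a
    product is therefore a single coordinate of the other factor. For [B_i] and [X_l] the indices
    have different types and are compared as numbers. *)
Definition ldiv (x c : B) : option B :=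
  match x, c with
  | bE v, _ => if Eleft c == v then Some c else None
  | bA i, bA l => if i == l then Some (bE g None) else None
  | bA i, bY l => if i == l then Some (bB g i) else None
  | bB i, bB l => if i == l then Some (bE g (Some i)) else None
  | bB i, bX l => if i == l :> nat then Some (bA g i) else None
  | bY i, bY l => if i == l then Some (bE g (Some i)) else None
  | bX i, bX l => if i == l then Some (bE g None) else None
  | _, _ => None
  end.

Definition rdiv (c x : B) : option B :=
  match x, c with
  | bE v, _ => if Eright c == v then Some c else None
  | bA i, bA l => if i == l then Some (bE g (Some i)) else None
  | bA i, bX l => if i == l :> nat then Some (bB g i) else None
  | bB i, bB l => if i == l then Some (bE g None) else None
  | bB i, bY l => if i == l then Some (bA g i) else None
  | bY i, bY l => if i == l then Some (bE g (Some i)) else None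
  | bX i, bX l => if i == l then Some (bE g None) else None
  | _, _ => None
  end.

Lemma mul_BA_X (i : 'I_n) (l : 'I_g) :
  (omap (bX n) (insub (val i)) == Some (bX n l)) = (i == l :> nat).
Proof.
case: insubP => [u _ ui|] /=; last first.
  move=> il; apply/esym/negbTE; apply: contraNN il => /eqP il.
  by rewrite -[val i]/(nat_of_ord i) il ltn_ord.
by rewrite -[RHS]/(val i == val l) -ui.
Qed.

Lemma ldivP x b c : (Ebasis_mul x b == Some c) = (ldiv x c == Some b).
Proof.
case: x => [v|i|i|i|i]; case: b => [w|i'|i'|i'|i']; case: c => [u|l|l|l|l] //=.
all: repeat match goal with
  |- context [if ?a == ?b then _ else _] => case: (@eqP _ a b) => ? end.
all: rewrite ?mul_BA_X.
all: try (case: insubP => /= [? _ _|_]).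
all: try done.
all: try (by rewrite eq_sym).
all: try (by apply/esym/eqP; congruence).
all: try (by apply/eqP; congruence).
all: try (by apply/eqP/eqP => -[*]; congruence).
Qed.

Lemma rdivP x b c : (Ebasis_mul b x == Some c) = (rdiv c x == Some b).
Proof.
case: x => [v|i|i|i|i]; case: b => [w|i'|i'|i'|i']; case: c => [u|l|l|l|l] //=.
all: repeat match goal with
  |- context [if ?a == ?b then _ else _] => case: (@eqP _ a b) => ? end.
all: rewrite ?mul_BA_X.
all: try (case: insubP => /= [? _ _|_]).
all: try done.
all: try (by rewrite eq_sym).
all: try (by apply/esym/eqP; congruence).
all: try (by apply/eqP; congruence).
all: try (by apply/eqP/eqP => -[*]; congruence).
Qed.

Lemma oapp_Evec b c : oapp (@Evec k g n) 0 b c = (b == Some c)%:R.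
Proof. by case: b => [b|] /=; rewrite ffunE // eq_sym. Qed.

Lemma coordB (x y : E) c : (x - y) c = x c - y c.
Proof. by rewrite !ffunE. Qed.

Lemma coordZ a (x : E) c : (a *: x) c = a * x c.
Proof. by rewrite ffunE. Qed.

Lemma coord_mull x (y : E) c : (Evec k x * y) c = oapp y 0 (ldiv x c).
Proof.
rewrite [y in LHS]Evec_sum mulr_sumr sum_ffunE.
rewrite (eq_bigr (fun b => (ldiv x c == Some b)%:R * y b)) => [|b _]; last first.
  by rewrite -scalerAr Evec_mul !ffunE oapp_Evec ldivP mulrC.
case: ldiv => [b|] /=; last by rewrite big1 // => b _; rewrite mul0r.
rewrite (bigD1 b) //= eqxx mul1r big1 ?addr0 // => b' bb'.
by rewrite -[Some b == _]/(b == b') eq_sym (negPf bb') mul0r.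
Qed.

Lemma coord_mulr x (y : E) c : (y * Evec k x) c = oapp y 0 (rdiv c x).
Proof.
rewrite [y in LHS]Evec_sum mulr_suml sum_ffunE.
rewrite (eq_bigr (fun b => (rdiv c x == Some b)%:R * y b)) => [|b _]; last first.
  by rewrite -scalerAl Evec_mul !ffunE oapp_Evec rdivP mulrC.
case: rdiv => [b|] /=; last by rewrite big1 // => b _; rewrite mul0r.
rewrite (bigD1 b) //= eqxx mul1r big1 ?addr0 // => b' bb'.
by rewrite -[Some b == _]/(b == b') eq_sym (negPf bb') mul0r.
Qed.

(* Nonidempotent left or right factors lower the rank, so the values of a cochain
   can be treated one rank at a time.  Among the idempotents [e_O] comes first:
   for words of length 7 and 8 the values at [e_i] are only seen to vanish once
   those at [e_O] do. *)
Definition rank (b : B) : nat :=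
  match b with
  | bE None => 0 | bE _ => 1 | bA _ | bB _ => 2 | bY _ | bX _ => 3
  end.

Lemma ldiv_rank x b c : ldiv x c = Some b ->
  x = bE g (Eleft c) /\ b = c \/ x != bE g (Eleft c) /\ (rank b < rank c)%N.
Proof.
case: x => [v|i|i|i|i]; case: c => [u|l|l|l|l] //=; case: eqP => // ? [<-];
  by [right | left; split=> //; congr (bE g _)].
Qed.

Lemma rdiv_rank x b c : rdiv c x = Some b ->
  x = bE g (Eright c) /\ b = c \/ x != bE g (Eright c) /\ (rank b < rank c)%N.
Proof.
case: x => [v|i|i|i|i]; case: c => [u|l|l|l|l] //=; case: eqP => // ? [<-];
  by [right | left; split=> //; congr (bE g _)].
Qed.

Lemma ldiv_id c : ldiv (bE g (Eleft c)) c = Some c. Proof. by rewrite /= eqxx. Qed.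
Lemma rdiv_id c : rdiv c (bE g (Eright c)) = Some c. Proof. by rewrite /= eqxx. Qed.

(** A form of the coordinate at [c] of [merges] that reduces by computation on explicit words. *)
Fixpoint coord_merges_word F (c : B) (w : seq B) : k :=
  if w is x :: r then
    (if r is y :: s then oapp (fun z => F (z :: s) c) 0 (Ebasis_mul x y)
     else oapp (F [::]) 0 (rdiv c x)) - coord_merges_word (F \o cons x) c r
  else 0.

Lemma coord_mergesE F c w : merges (@right_act k g n) F w c = coord_merges_word F c w.
Proof.
elim: w F => [|x r IH] F; first by rewrite ffunE.
rewrite merges_cons coordB IH /=; congr (_ - _).
case: r {IH} => [|y s] /=; first exact: coord_mulr.
by case: Ebasis_mul => //=; rewrite ffunE.
Qed.

Lemma coord_word_diff j F c x r : word_diff j F (x :: r) c =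
  koszul k j x * oapp (F r) 0 (ldiv x c) - coord_merges_word F c (x :: r).
Proof. by rewrite /word_diff coordB coordZ coord_mull coord_mergesE. Qed.

Lemma coord_mull_low x (y : E) c : (forall b, (rank b < rank c)%N -> y b = 0) ->
  (Evec k x * y) c = (x == bE g (Eleft c))%:R * y c.
Proof.
move=> y0; rewrite coord_mull; case xc: (ldiv x c) => [b|] /=.
  by case: (ldiv_rank xc) => [[-> ->]|[/negPf-> /y0->]]; rewrite ?eqxx ?mul1r ?mul0r.
by case: eqP xc => [->|_ _]; rewrite ?ldiv_id // mul0r.
Qed.

Lemma coord_mulr_low x (y : E) c : (forall b, (rank b < rank c)%N -> y b = 0) ->
  (y * Evec k x) c = (x == bE g (Eright c))%:R * y c.
Proof.
move=> y0; rewrite coord_mulr; case xc: (rdiv c x) => [b|] /=.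
  by case: (rdiv_rank xc) => [[-> ->]|[/negPf-> /y0->]]; rewrite ?eqxx ?mul1r ?mul0r.
by case: eqP xc => [->|_ _]; rewrite ?rdiv_id // mul0r.
Qed.

Lemma coord_merges_low F w c :
  (forall t b, (size t).+1 = size w -> (rank b < rank c)%N -> F t b = 0) ->
  merges (@right_act k g n) F w c = merges (@simple_act g n k (Eright c)) (fun t => F t c) w.
Proof.
elim: w F => [|x r IH] F F0; first by rewrite ffunE.
rewrite !merges_cons coordB IH; last by move=> t b tr; apply: F0; rewrite /= tr.
congr (_ - _); case: r {IH} F0 => [|y s] F0 /=; last by case: Ebasis_mul => //=; rewrite ffunE.
by rewrite coord_mulr_low // => b; apply: F0.
Qed.

(** A nonidempotent outer factor would need a coordinate of lower rank, and those vanish. Only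
    idempotents still act; they have degree 0, so the Koszul sign disappears. *)
Lemma coord_word_diff_low j F w c :
  (forall t b, (size t).+1 = size w -> (rank b < rank c)%N -> F t b = 0) ->
  word_diff j F w c = simple_diff (Eright c) (Eleft c) (fun t => F t c) w.
Proof.
case: w => [|x r] F0; first by rewrite ffunE.
rewrite /word_diff coordB coordZ coord_merges_low // coord_mull_low => [|b]; last exact: F0.
rewrite /simple_diff; congr (_ - _); case: eqP => [->|_]; last by rewrite !mul0r mulr0.
by rewrite /koszul mulr0 expr0z !mul1r.
Qed.

Lemma wdeg_cons x w : wdeg (x :: w) = (Edeg x)%:Z + wdeg w.
Proof. by []. Qed.

(** Multiplication preserves degree and [simple_act] is nonzero only on an idempotent, of degree 0.
    This allows a scalar primitive to be cut down to its homogeneous part. *)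
Lemma merges_wdeg u (F : seq B -> k) d w :
  merges (@simple_act g n k u) (fun t => if wdeg t == d then F t else 0) w
    = if wdeg w == d then merges (@simple_act g n k u) F w else 0.
Proof.
elim: w F d => [|x r IH] F d; first by case: ifP.
have shift (t : seq B) (y : B) : (wdeg (y :: t) == d) = (wdeg t == d - (Edeg y)%:Z).
  by rewrite wdeg_cons addrC; apply/eqP/eqP => [<-|->]; rewrite ?addrK ?subrK.
rewrite !merges_cons (_ : merges _ _ r =
  if wdeg (x :: r) == d then merges (simple_act u) (F \o cons x) r else 0).
  case: r {IH} => [|y s] /=.
    rewrite /simple_act wdeg_cons; case: eqP => [->|]; first by rewrite !add0r; case: ifP;
      rewrite ?mulr0 ?subr0.
    by rewrite !mul0r; case: ifP; rewrite ?subr0.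
  case E: Ebasis_mul => [z|] /=; last by case: ifP; rewrite ?subr0.
  rewrite (_ : wdeg (z :: s) = wdeg [:: x, y & s]); first by case: ifP; rewrite ?subr0.
  by rewrite !wdeg_cons (Edeg_mul E) PoszD addrA.
rewrite shift -IH; apply: eq_merges => t _ /=.
by rewrite shift.
Qed.

Lemma simple_diff_wdeg u x (F : seq B -> k) d w :
  simple_diff u x (fun t => if wdeg t == d then F t else 0) w
    = if wdeg w == d then simple_diff u x F w else 0.
Proof.
case: w => [|y r]; first by case: ifP.
rewrite /simple_diff merges_wdeg; case: eqP => [->|_]; last first.
  by rewrite !mul0r; case: ifP; rewrite ?subr0.
by rewrite wdeg_cons add0r; case: ifP; rewrite ?mulr0 ?subr0.
Qed.

Lemma word_diffD j F H w : word_diff j (fun t => F t + H t) w = word_diff j F w + word_diff j H w.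
Proof.
case: w => [|x r]; first by rewrite addr0.
by rewrite /word_diff (mergesD right_actD) mulrDr scalerDr !opprD addrACA.
Qed.

Lemma merges_homog j F w c :
  (forall t b, (size t).+1 = size w -> (Edeg b)%:Z != wdeg t + j -> F t b = 0) ->
  (Edeg c)%:Z != wdeg w + j -> merges (@right_act k g n) F w c = 0.
Proof.
elim: w F j => [|x r IH] F j F0 cw; first by rewrite ffunE.
(* Prepending [x] turns internal degree [j] into [j + Edeg x]. *)
rewrite merges_cons coordB (IH _ (j + (Edeg x)%:Z)); last 2 first.
- move=> t b tr bt; apply: F0; first by rewrite /= tr.
  by rewrite wdeg_cons; apply: contra_neq bt => ->; ring.
- by apply: contra_neq cw => ->; rewrite wdeg_cons; ring.
rewrite subr0; case: r {IH} F0 cw => [|y s] F0 cw /=.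
  rewrite coord_mulr; case E: rdiv => [b|] //=; move/eqP: E; rewrite -rdivP => /eqP E.
  apply: F0 => //; apply: contra_neq cw => bj; rewrite (Edeg_mul E) PoszD bj wdeg_cons; ring.
case E: Ebasis_mul => [z|] /=; last by rewrite ffunE.
apply: F0 => //; apply: contra_neq cw => ->.
by rewrite !wdeg_cons (Edeg_mul E) PoszD; ring.
Qed.

Lemma word_diff_homog m j H : homog_words m j H -> homog_words m.+1 j (word_diff j H).
Proof.
move=> hH [|x r] // rm c; apply: contra_neq_eq => cw.
have H0 t b : (size t).+1 = m.+1 -> (Edeg b)%:Z != wdeg t + j -> H t b = 0.
  by move=> [tm] bt; apply/eqP; apply: contra_neqT bt => Hb; apply: hH.
rewrite /word_diff coordB coordZ (@merges_homog j) //; last by move=> t b tr; apply: H0; rewrite tr.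
rewrite subr0 coord_mull; case E: ldiv => [b|] /=; last by rewrite mulr0.
move/eqP: E; rewrite -ldivP => /eqP E; rewrite H0 ?mulr0 //.
apply: contra_neq cw => bj; rewrite (Edeg_mul E) PoszD bj wdeg_cons; ring.
Qed.

Lemma word_diffB j F H w : word_diff j (fun t => F t - H t) w = word_diff j F w - word_diff j H w.
Proof.
case: w => [|x r]; first by rewrite subr0.
rewrite /word_diff (mergesD right_actD) (mergesN right_actD) mulrBr scalerBr !opprD !opprK.
by rewrite addrACA.
Qed.

End Algebra.

(** * Removing the values of a cocycle rank by rank *)

Section Layers.
Variables (k : fieldType) (n : nat).
Local Notation B := (Ebasis n n).
Local Notation E := (Egn k n n).
Implicit Types (F H : seq B -> E) (w : seq B).

Definition low_vanish m r F := forall w c, size w = m -> (rank c < r)%N -> F w c = 0.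

Definition critical_vanish m j r := forall F, homog_words m.+1 j F ->
  (forall w, size w = m.+2 -> word_diff j F w = 0) -> low_vanish m.+1 r F ->
  forall w c, size w = m.+1 -> rank c = r -> (Edeg c)%:Z = wdeg w + j ->
    critical (Eright c) (Eleft c) w -> F w c = 0.

(** With all lower ranks gone, each coordinate of rank [r] is a scalar cocycle, to which
    [simple_exactness] applies. *)
Lemma layer_step m j r F : critical_vanish m j r -> homog_words m.+1 j F ->
  (forall w, size w = m.+2 -> word_diff j F w = 0) -> low_vanish m.+1 r F ->
  exists2 H, homog_words m j H & low_vanish m.+1 r.+1 (fun w => F w - word_diff j H w).
Proof.
move=> cz hF cF lF.
have /fin_all_exists[psi psiE] (c : B) : exists psi : seq B -> k, rank c = r ->
    forall w, size w = m.+1 -> F w c = simple_diff (Eright c) (Eleft c) psi w.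
  case: (eqVneq (rank c) r) => [cr|/eqP cr]; last by exists (fun=> 0).
  have [||psi psiE] := @simple_exactness n k (Eright c) m.+1 (Eleft c) (fun t => F t c).
  - move=> w wm; rewrite -[LHS](@coord_word_diff_low k n n j F w c) ?cF ?ffunE // => t b tw.
    by rewrite cr; apply: lF; move: tw; rewrite wm => -[].
  - move=> w wm cw; case: (eqVneq (F w c) 0) => // Fc.
    by apply: cz => //; apply: hF.
  by exists psi => _.
(* The primitives are placed in rank [r] only, so lower ranks stay zero, and are cut to the word
   degree that makes [H] homogeneous of degree [j]. *)
pose H w : E := [ffun c => if rank c == r then
  if wdeg w == (Edeg c)%:Z - j then psi c w else 0 else 0].
exists H.
  move=> w wm c; rewrite ffunE; case: ifP => _; last by rewrite eqxx.
  by case: (wdeg w =P _) => [->|_]; rewrite ?eqxx // subrK.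
move=> w c wm; rewrite ltnS leq_eqVlt !ffunE => /orP cr.
rewrite coord_word_diff_low => [|t b _ bc]; last first.
  rewrite ffunE; case: eqP => // br; move: bc; rewrite br.
  by case: cr => [/eqP->|cr]; rewrite ?ltnn // ltnNge ltnW.
case: cr => [/eqP cr|cr].
  rewrite (_ : simple_diff _ _ _ w = if wdeg w == (Edeg c)%:Z - j then F w c else 0); last first.
    rewrite psiE // -simple_diff_wdeg; apply: eq_simple_diff => t.
    by rewrite ffunE cr eqxx.
  case: eqP => [_|wd]; first by rewrite subrr.
  rewrite subr0; apply/eqP; apply: contra_notT wd => /(hF _ wm) ->.
  by rewrite addrK.
rewrite lF // sub0r simple_diff0 ?oppr0 // => t; rewrite ffunE.
by rewrite ltn_eqF.
Qed.

(** The ranks are 0 to 3, so four successive corrections by coboundaries exhaust the cocycle. *)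
Lemma cobound_of_critical m j : (forall r, (r < 4)%N -> critical_vanish m j r) ->
  @cobound_words k n n m j.
Proof.
move=> cz F hF cF.
suff /(_ 4 isT) [H hH lH] r : (r <= 4)%N ->
    exists2 H, homog_words m j H & low_vanish m.+1 r (fun w => F w - word_diff j H w).
  exists H => // w wm; apply/eqP; rewrite -subr_eq0; apply/eqP/ffunP => c.
  by rewrite lH // ?ffunE //; case: c => [[]||||].
elim: r => [|r IH] r4.
  by exists (fun=> 0) => // w wm c; rewrite ffunE eqxx.
have [H hH lH] := IH (ltnW r4).
have [||H' hH' lH'] := @layer_step m j r (fun w => F w - word_diff j H w) (cz r r4) _ _ lH.
- move=> w wm c; rewrite coordB; case: (eqVneq (F w c) 0) => [->|Fc _]; last exact: hF.
  by rewrite sub0r oppr_eq0; apply: (word_diff_homog hH).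
- by move=> w wm; rewrite word_diffB cF // word_diff_word_diff subr0.
exists (fun w => H w + H' w).
  move=> w wm c; rewrite ffunE; case: (eqVneq (H w c) 0) => [->|Hc _]; last exact: hH.
  by rewrite add0r; apply: hH'.
move=> w c wm cr; rewrite -(lH' w c wm cr).
by rewrite word_diffD opprD addrA.
Qed.

End Layers.

(** * Length and shape of the critical words *)

Section Counting.
Variable n : nat.
Local Notation B := (Ebasis n n).
Local Notation A := (@bA n n).
Local Notation X := (@bX n n).
Local Notation Y := (@bY n n).
Local Notation B_ := (@bB n n).

Lemma stepE (c z : B) : step c z =
  match c, z with
  | bX _, bB _ => true
  | bA i, bX l => l == i
  | bA i, bB l => l != i
  | bB i, bY l => l == i
  | bY i, bA l => l == i
  | _, _ => false
  end.
Proof.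
case: c => [v|i|i|i|i]; case: z => [w|l|l|l|l]; rewrite /step /= ?eq_EbasisE ?orbF ?andbF //.
- by rewrite -[Some l == Some i]/(l == i) andbC; case: eqP.
- by rewrite -[Some l == Some i]/(l == i); case: eqP.
by rewrite andbT.
Qed.

Definition isA (b : B) : bool := if b is bA _ then true else false.
(* The letters between two consecutive [A]s in a critical word form a subword of
   [X B Y]; [phase] is the position in the period [A X B Y]. *)
Definition phase (b : B) : nat := match b with bX _ => 1 | bB _ => 2 | bY _ => 3 | _ => 0 end.

(** Every step raises [phase], except a step into an [A], which resets it from 3 to 0. *)
Lemma step_size c r : path (@step n) c r -> (size r + phase c <= 4 * count isA r + 3)%N.
Proof.
elim: r c => [|z r IH] c /=; first by case: c.
by move=> /andP[+ /IH]; rewrite stepE; case: c => [v|i|i|i|i]; case: z => //=; lia.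
Qed.

(** A path ending at [O] ends in an [A] or an [X], so its final [phase] is at most 1 instead of
    3. *)
Lemma step_size_O c r : path (@step n) c r -> one_letter c || two_letter c ->
  Eright (last c r) = None -> (size r + phase c <= 4 * count isA r + 1)%N.
Proof.
elim: r c => [|z r IH] c /=; first by case: c.
move=> /andP[cz zr] _ lr; have zl : one_letter z || two_letter z.
  by move: cz; rewrite stepE; case: (c); case: (z).
have := IH z zr zl lr; move: cz; rewrite stepE.
by case: c => [v|i|i|i|i]; case: (z) => //=; lia.
Qed.

Lemma step_wdeg c r : path (@step n) c r -> (size r)%:Z = wdeg r + (count isA r)%:Z.
Proof.
elim: r c => //= z r IH c /andP[cz /IH]; rewrite wdeg_cons.
by move: cz; rewrite stepE; case: c => [v|i|i|i|i]; case: z => //=; lia.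
Qed.

Lemma critical_wdeg u x w : critical u x w -> (size w)%:Z = wdeg w + (count isA w)%:Z.
Proof.
case: w => [|z w] //= /and4P[z1 _ /step_wdeg + _]; rewrite wdeg_cons.
by case: z z1 => //= l _; lia.
Qed.

(** The first letter is an [A] or a [B], according to the left vertex of [c]. Feeding it into the
    two length bounds gives at most 6 letters for nonidempotent [c] and at most 8 for an
    idempotent. *)
Lemma critical_long (w : seq B) c : critical (Eright c) (Eleft c) w ->
  (Edeg c + count isA w = 2)%N -> (7 <= size w)%N ->
  (size w <= 8)%N /\ exists v, c = bE n v.
Proof.
case: w => [|z w] //= /and4P[z1 /eqP zc pw /eqP lw] dA sw.
have s1 := step_size pw.
have s2 : Eright c = None ->
    _ := fun cN => step_size_O pw (introT orP (or_introl z1)) (etrans lw cN).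
case: c zc lw dA s2 => [v|i|i|i|i] /=; case: z z1 pw s1 => //= l _ pw s1 zc lw dA s2;
  try by [exfalso; lia | exfalso; move: (s2 erefl); lia].
- by split; [lia | exists v].
- by move: s2; rewrite -zc => /(_ erefl) s2; split; [lia | exists None].
Qed.

Lemma path_B i r : path (@step n) (B_ i) r ->
  r = [::] \/ exists2 s, r = Y i :: s & path (@step n) (Y i) s.
Proof.
case: r => [|z s]; [by left | rewrite /= stepE => /andP[zi ps]; right].
by exists s; case: z zi ps => //= l /eqP ->.
Qed.

Lemma path_Y i r : path (@step n) (Y i) r ->
  r = [::] \/ exists2 s, r = A i :: s & path (@step n) (A i) s.
Proof.
case: r => [|z s]; [by left | rewrite /= stepE => /andP[zi ps]; right].
by exists s; case: z zi ps => //= l /eqP ->.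
Qed.

Lemma path_X i r : path (@step n) (X i) r ->
  r = [::] \/ exists l, exists2 s, r = B_ l :: s & path (@step n) (B_ l) s.
Proof.
case: r => [|z s]; [by left | rewrite /= stepE => /andP[zi ps]; right].
by case: z zi ps => //= l _; exists l, s.
Qed.

Lemma path_A i r : path (@step n) (A i) r ->
  [\/ r = [::], exists2 s, r = X i :: s & path (@step n) (X i) s
  | exists l, l != i /\ exists2 s, r = B_ l :: s & path (@step n) (B_ l) s].
Proof.
case: r => [|z s]; [by constructor 1 | rewrite /= stepE => /andP[zi ps]].
case: z zi ps => //= l; last by move=> /eqP ->; constructor 2; exists s.
by move=> li ps; constructor 3; exists l; split; [|exists s].
Qed.

(** Uncovers one more letter along [step], discharging branches that contradict the length, the
    final vertex or the number of [A]s. *)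
Ltac next_letter p sz lw cw :=
  lazymatch type of p with
  | is_true (path _ (bB _ _) _) =>
    case: (path_B p) sz lw cw => {p} [->|[? -> p]] //= sz lw cw
  | is_true (path _ (bY _ _) _) =>
    case: (path_Y p) sz lw cw => {p} [->|[? -> p]] //= sz lw cw
  | is_true (path _ (bX _ _) _) =>
    case: (path_X p) sz lw cw => {p} [->|[? [? -> p]]] //= sz lw cw
  | is_true (path _ (bA _ _) _) =>
    case: (path_A p) sz lw cw => {p} [->|[? -> p]|[? [? [? -> p]]]] //= sz lw cw
  end.

(** In length 8 the word runs through the period without omission. In length 7 exactly one letter is
    missing: an [X] between an [A] and a [B], or the last letter. *)
Lemma critical_O8 (w : seq B) : critical None None w -> count isA w = 2 -> size w = 8 ->
  exists i l, w = [:: B_ i; Y i; A i; X i; B_ l; Y l; A l; X l].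
Proof.
case: w => [|z w] //= /and4P[z1 zl p lw] cw sz; case: z z1 zl p lw cw => //= i _ _ p lw cw.
do 8 next_letter p sz lw cw.
by do 2 eexists.
Qed.

Lemma critical_O7 (w : seq B) : critical None None w -> count isA w = 2 -> size w = 7 ->
  exists i l, w = [:: B_ i; Y i; A i; X i; B_ l; Y l; A l] \/
    l != i /\ w = [:: B_ i; Y i; A i; B_ l; Y l; A l; X l].
Proof.
case: w => [|z w] //= /and4P[z1 zl p lw] cw sz; case: z z1 zl p lw cw => //= i _ _ p lw cw.
do 7 next_letter p sz lw cw.
all: by do 2 eexists; first [by left | by right; split; last by []].
Qed.

Lemma critical_P8 v (w : seq B) : critical (Some v) (Some v) w -> count isA w = 2 -> size w = 8 ->
  exists l, w = [:: A v; X v; B_ l; Y l; A l; X l; B_ v; Y v].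
Proof.
case: w => [|z w] //= /and4P[z1 zl p lw] cw sz; case: z z1 zl p lw cw => //= i _ /eqP[->] p lw cw.
do 8 next_letter p sz lw cw.
all: by case/eqP: lw => ->; eexists.
Qed.

Lemma critical_P7 v (w : seq B) : critical (Some v) (Some v) w -> count isA w = 2 -> size w = 7 ->
  exists l, w = [:: A v; X v; B_ l; Y l; A l; X l; B_ v] \/
    l != v /\ (w = [:: A v; X v; B_ l; Y l; A l; B_ v; Y v] \/
               w = [:: A v; B_ l; Y l; A l; X l; B_ v; Y v]).
Proof.
case: w => [|z w] //= /and4P[z1 zl p lw] cw sz; case: z z1 zl p lw cw => //= i _ /eqP[->] p lw cw.
do 7 next_letter p sz lw cw.
all: case/eqP: lw => ?; subst; eexists.
- by left.
- by right; split; [rewrite eq_sym; eassumption | left].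
- by right; split; [eassumption | right].
Qed.

End Counting.

(** * Cocycle identities that kill the remaining idempotent values *)

Section Evaluation.
Variables (k : fieldType) (n : nat) (j : int).
Local Notation B := (Ebasis n n).
Local Notation E := (Egn k n n).
Local Notation A := (@bA n n).
Local Notation X := (@bX n n).
Local Notation Y := (@bY n n).
Local Notation B_ := (@bB n n).
Implicit Types (F : seq B -> E).

Ltac simp_diff := rewrite ?(valK, eqxx) /= ?(subr0, sub0r, opprK, mulr0, addr0, add0r, oppr0).

Lemma oppB_eq0 (a b : k) : - (a - b) = 0 -> a = b.
Proof. by move/eqP; rewrite oppr_eq0 subr_eq0 => /eqP. Qed.

Ltac eval_at cF w c :=
  have := congr1 (fun v : E => v c) (cF w erefl);
  rewrite coord_word_diff ffunE /=; simp_diff.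

(** Append [B_h] and read the coordinate at [B_h]. All adjacent products vanish, and [h != i]
    removes the term multiplied by the first letter [B_i]. *)
Lemma eval_O8 F i l h : (forall w, size w = 9 -> word_diff j F w = 0) -> h != i ->
  F [:: B_ i; Y i; A i; X i; B_ l; Y l; A l; X l] (bE n None) = 0.
Proof.
move=> cF hi; have ih : (i == h) = false by rewrite eq_sym (negPf hi).
eval_at cF [:: B_ i; Y i; A i; X i; B_ l; Y l; A l; X l; B_ h] (B_ h).
by rewrite ih; simp_diff => /eqP; rewrite oppr_eq0 => /eqP.
Qed.

(** Append [A_v] and read the coordinate at [A_v]. The term multiplied by the first letter [A_v] is
    a value at [e_O], zero by assumption. *)
Lemma eval_P8 F v l : (forall w, size w = 9 -> word_diff j F w = 0) ->
  (forall w, size w = 8 -> F w (bE n None) = 0) ->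
  F [:: A v; X v; B_ l; Y l; A l; X l; B_ v; Y v] (bE n (Some v)) = 0.
Proof.
move=> cF F0.
eval_at cF [:: A v; X v; B_ l; Y l; A l; X l; B_ v; Y v; A v] (A v).
by rewrite F0 //; simp_diff => /eqP; rewrite oppr_eq0 => /eqP.
Qed.

Lemma eval_O7a F i l h : (forall w, size w = 8 -> word_diff j F w = 0) -> h != i -> l != i ->
  F [:: B_ i; Y i; A i; B_ l; Y l; A l; X l] (bE n None) = 0.
Proof.
move=> cF hi li; have ih : (i == h) = false by rewrite eq_sym (negPf hi).
have il : (i == l) = false by rewrite eq_sym (negPf li).
eval_at cF [:: B_ i; Y i; A i; B_ l; Y l; A l; X l; B_ h] (B_ h).
by rewrite ih il; simp_diff.
Qed.

Lemma eval_O7b F i h : (forall w, size w = 8 -> word_diff j F w = 0) -> h != i ->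
  F [:: B_ i; Y i; A i; X i; B_ i; Y i; A i] (bE n None) = 0.
Proof.
move=> cF hi; have ih : (i == h) = false by rewrite eq_sym (negPf hi).
eval_at cF [:: B_ i; Y i; A i; X i; B_ i; Y i; A i; B_ h] (B_ h).
by rewrite ih; simp_diff.
Qed.

(** When [g = 2], only [B_i] can be appended with zero product, and then the term multiplied by the
    first letter survives. It involves the value at [e_i] of a word starting with [Y_i], [A_i],
    [X_i]; the first two identities, which split [Y_i] and then [X_i], show this value to be
    zero. *)
Lemma eval_O7c F i l : (forall w, size w = 8 -> word_diff j F w = 0) -> l != i ->
  F [:: B_ i; Y i; A i; X i; B_ l; Y l; A l] (bE n None) = 0.
Proof.
move=> cF li; have il : (i == l) = false by rewrite eq_sym (negPf li).
eval_at cF [:: A i; B_ i; A i; X i; B_ l; Y l; A l; B_ i] (bE n (Some i)).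
rewrite ?il ?(negPf li); simp_diff.
eval_at cF [:: A i; X i; B_ i; A i; B_ l; Y l; A l; B_ i] (bE n (Some i)).
rewrite ?il ?(negPf li); simp_diff.
eval_at cF [:: B_ i; Y i; A i; X i; B_ l; Y l; A l; B_ i] (B_ i).
rewrite ?il ?(negPf li); simp_diff => e0 /eqP e1 /oppB_eq0 e2.
by move: e1 e0; rewrite oppr_eq0 e2 => /eqP ->; rewrite mulr0 add0r.
Qed.

Lemma eval_P7a F v l : (forall w, size w = 8 -> word_diff j F w = 0) ->
  (forall w, size w = 7 -> F w (bE n None) = 0) -> l != v ->
  F [:: A v; X v; B_ l; Y l; A l; B_ v; Y v] (bE n (Some v)) = 0.
Proof.
move=> cF F0 lv; have vl : (v == l) = false by rewrite eq_sym (negPf lv).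
eval_at cF [:: A v; X v; B_ l; Y l; A l; B_ v; Y v; A v] (A v).
by rewrite F0 //; rewrite ?vl ?(negPf lv); simp_diff.
Qed.

Lemma eval_P7b F v l : (forall w, size w = 8 -> word_diff j F w = 0) ->
  (forall w, size w = 7 -> F w (bE n None) = 0) -> l != v ->
  F [:: A v; B_ l; Y l; A l; X l; B_ v; Y v] (bE n (Some v)) = 0.
Proof.
move=> cF F0 lv; have vl : (v == l) = false by rewrite eq_sym (negPf lv).
eval_at cF [:: A v; B_ l; Y l; A l; X l; B_ v; Y v; A v] (A v).
by rewrite F0 //; rewrite ?vl ?(negPf lv); simp_diff.
Qed.

(** Appending [A_v] merges [B_v A_v] into [X_v], so the wanted value equals a value at [A_v]. Three
    identities with split letters move the merged letter to the front, until the word starts with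
    [Y_v]; multiplying by [B_v] on the left then isolates the value, up to a Koszul sign. *)
Lemma eval_P7c F v l : (forall w, size w = 8 -> word_diff j F w = 0) ->
  (forall w, size w = 7 -> F w (bE n None) = 0) ->
  F [:: A v; X v; B_ l; Y l; A l; X l; B_ v] (bE n (Some v)) = 0.
Proof.
move=> cF F0.
eval_at cF [:: A v; X v; B_ l; Y l; A l; X l; B_ v; A v] (A v).
eval_at cF [:: A v; X v; B_ l; Y l; A l; B_ l; A l; X v] (A v).
eval_at cF [:: A v; X v; B_ l; A l; B_ l; Y l; A l; X v] (A v).
eval_at cF [:: A v; B_ v; A v; X l; B_ l; Y l; A l; X v] (A v).
eval_at cF [:: B_ v; Y v; A v; X l; B_ l; Y l; A l; X v] (X v).
rewrite !F0 //; simp_diff => e0 /oppB_eq0 e1 /oppB_eq0 e2 /oppB_eq0 e3 /oppB_eq0 e4.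
move/eqP: e0; rewrite e1 e2 e3 e4.
by rewrite mulf_eq0 /koszul expfz_eq0 oppr_eq0 oner_eq0 andbF => /eqP.
Qed.

End Evaluation.

(** * Vanishing for [n = g] *)

Section Part_i.
Variables (k : fieldType) (n : nat).

Lemma HH_vanish m : (7 <= m.+1)%N -> ((m.+1 <= 8)%N -> (1 < n)%N) ->
  HH_eq0 (Egr k n n) m.+1 (2 - m.+1%:Z).
Proof.
move=> m7 n2; apply/HH_eq0_words/cobound_of_critical => r r4 F hF cF lF w c wm cr cd cw.
(* Every letter of a critical word except [A] has degree 1, so internal degree [2 - i] becomes this
   count. *)
have dA : (Edeg c + count (@isA n) w = 2)%N.
  by have := critical_wdeg cw; rewrite wm; lia.
have [m8 [v cE]] := critical_long cw dA (eq_ind_r (fun s => (7 <= s)%N) m7 wm).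
rewrite wm in m8; have {n2}n1 := n2 m8; rewrite cE /= add0n in cr cw dA *.
(* The evaluations at [e_O] append a letter with a second index; this is where [1 < n] enters. *)
have other (i : 'I_n) : exists h : 'I_n, h != i.
  case: n n1 i {r4 F hF cF lF w c wm cr cd cw dA v cE} => [|[|p]] // _ i.
  case: (eqVneq i ord0) => [->|i0]; first by exists ord_max.
  by exists ord0; rewrite eq_sym.
have cF' d (md : m.+1 = d) u : size u = d.+1 -> word_diff (2 - m.+1%:Z) F u = 0.
  by move=> ud; apply: cF; rewrite md.
case: v cr cw {cE cd} => [v|] /= rkE cw; last first.
  have [m6|m7'] : m.+1 = 7 \/ m.+1 = 8 by lia.
    have [i [l [->|[li ->]]]] := critical_O7 cw dA (etrans wm m6).
      case: (eqVneq l i) => [->|li]; last exact: (eval_O7c (cF' _ m6)).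
      by have [h hi] := other i; apply: (eval_O7b (cF' _ m6) hi).
    by have [h hi] := other i; apply: (eval_O7a (cF' _ m6) hi).
  have [i [l ->]] := critical_O8 cw dA (etrans wm m7').
  by have [h hi] := other i; apply: (eval_O8 _ (cF' _ m7') hi).
have F0 d (md : m.+1 = d) u : size u = d -> F u (bE n None) = 0.
  by move=> ud; apply: lF; rewrite ?md // -rkE.
have [m6|m7'] : m.+1 = 7 \/ m.+1 = 8 by lia.
  have [l [->|[lv [->|->]]]] := critical_P7 cw dA (etrans wm m6).
  - exact: (eval_P7c _ _ (cF' _ m6) (F0 _ m6)).
  - exact: (eval_P7a (cF' _ m6) (F0 _ m6)).
  - exact: (eval_P7b (cF' _ m6) (F0 _ m6)).
have [l ->] := critical_P8 cw dA (etrans wm m7').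
exact: (eval_P8 _ _ (cF' _ m7') (F0 _ m7')).
Qed.

End Part_i.

(** * A nontrivial class for [n < g] *)

Section Part_ii.
Variables (k : fieldType) (g n : nat).
Local Notation B := (Ebasis g n).
Local Notation E := (Egn k g n).
Implicit Types (Q : seq B -> k) (l : B).

Definition nonidem l : bool := if l is bE _ then false else true.

Definition prefixed l Q (w : seq B) : k := if w is z :: s then if z == l then Q s else 0 else 0.

Lemma mul_fix l y : nonidem l -> (Ebasis_mul l y == Some l) = (y == bE g (Eright l)).
Proof.
move=> ll; apply/eqP/eqP => [|->]; last by rewrite Ebasis_mule eqxx.
case: l ll => // i _; case: y => [v|h|h|h|h] //=; case: eqP => //.
- by move=> ->.
- by move=> ->.
- by case: insub.
- by move=> ->.
- by move=> ->.
Qed.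

(** Besides the differential of [Q], only nontrivial factorizations [l = x y] contribute. Prefixing
    an indecomposable letter thus preserves cocycles, with the vertices matched. *)
Lemma simple_diff_prefixed u l Q x r : nonidem l ->
  simple_diff u (Eleft l) (prefixed l Q) (x :: r) =
  if x == l then - simple_diff u (Eright l) Q r
  else if x == bE g (Eleft l) then 0
  else - (if r is y :: s then if ldiv x l == Some y then Q s else 0 else 0).
Proof.
move=> ll; rewrite /simple_diff merges_cons.
have le : l == bE g (Eleft l) = false by case: (l) ll.
case: (eqVneq x l) => [->|xl].
  rewrite le mul0r sub0r (_ : merges _ (prefixed l Q \o cons l) r =
    merges (@simple_act g n k u) Q r); last first.
    by apply: eq_merges => t _; rewrite /prefixed /= eqxx.
  case: r => [|y s]; first by rewrite /= /simple_act mulr0 subrr.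
  congr (- (_ - _)); rewrite /= -mul_fix //.
  case: Ebasis_mul => [z|] /=; last by rewrite mul0r.
  by rewrite -[Some z == _]/(z == l); case: (z == l); rewrite ?mul1r ?mul0r.
rewrite [X in _ - (_ - X)]merges_cons0 ?subr0; last by move=> t; rewrite /prefixed (negPf xl).
case: (eqVneq x (bE g (Eleft l))) => [->|xe].
  rewrite mul1r merge_head_idem; case: r => [|y s]; first by rewrite /= mulr0 subrr.
  rewrite /= ; case: (eqVneq y l) => [->|_]; last by rewrite mulr0 subrr.
  by rewrite eqxx mul1r subrr.
rewrite mul0r sub0r; congr (- _); case: r => [|y s] /=; first by rewrite /simple_act mulr0.
rewrite -ldivP.
by case: Ebasis_mul => [z|].
Qed.

Lemma prefixed_wdeg l Q d : (forall w, Q w != 0 -> wdeg w = d) ->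
  forall w, prefixed l Q w != 0 -> wdeg w = (Edeg l)%:Z + d.
Proof.
move=> Qd [|z s] /=; rewrite ?eqxx //; case: (z =P l) => [->|]; last by rewrite eqxx.
by move=> /Qd; rewrite wdeg_cons => ->.
Qed.

Definition empty_word (w : seq B) : k := (w == [::])%:R.

Lemma empty_word_cocycle u w : simple_diff u u empty_word w = 0.
Proof.
case: w => [|x [|y s]] //; first by rewrite /= /simple_act subr0 subrr.
rewrite /simple_diff merges0 ?mulr0 ?subr0 // => [b|[|z t] //]; exact: simple_act0.
Qed.

Section Cocycle.
Variables (i : 'I_n) (z x1 : 'I_g).
Hypothesis x1i : x1 = i :> nat.
Hypothesis zn : (n <= z)%N.
Local Notation Z := (bX n z).
Local Notation X1 := (bX n x1).

(** As [n <= z], the loop [Z] is not a product [B_h A_h]. *)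
Lemma ldiv_Z (x : B) : x != Z -> x != bE g None -> ldiv x Z = None.
Proof.
case: x => [[v|]|h|h|h|h]; rewrite ?eq_EbasisE //= => xZ _; last by rewrite (negPf xZ).
by case: eqP => // hz; move: zn; rewrite -hz leqNgt ltn_ord.
Qed.

Definition loop_power b := iter b (prefixed Z) empty_word.

Lemma prefixed_loop_closed Q : (forall w, simple_diff None None Q w = 0) ->
  forall w, simple_diff None None (prefixed Z Q) w = 0.
Proof.
move=> cQ [|x r] //; rewrite (@simple_diff_prefixed None Z) // cQ oppr0; case: ifP => // /negbT xZ.
case: ifP => // /negbT xe; case: r => [|y s]; first by rewrite oppr0.
by rewrite ldiv_Z ?oppr0.
Qed.

Definition loop_cocycle b : seq B -> k := fun w =>
  prefixed Z (fun t => prefixed (bB g i) (prefixed (bY g i) (prefixed (bA g i) (loop_power b))) t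
     + prefixed X1 (prefixed (bB g i) (prefixed (bA g i) (loop_power b))) t) w.

(** [Z], [A_i] and [B_i] are indecomposable, while [Y_i = A_i B_i] and [X_1 = B_i A_i]. Splitting
    [Y_i] in one summand and [X_1] in the other produces the same word [Z B_i A_i B_i A_i Z^b], with
    opposite signs. *)
Lemma loop_cocycle_closed b w : simple_diff None None (loop_cocycle b) w = 0.
Proof.
apply: prefixed_loop_closed => {}w.
have cZ t : simple_diff None None (loop_power b) t = 0.
  by elim: b t => [|b IH] t; [apply: empty_word_cocycle | apply: prefixed_loop_closed].
have cA t : simple_diff None (Some i) (prefixed (bA g i) (loop_power b)) t = 0.
  case: t => [|x r] //; rewrite (@simple_diff_prefixed None (bA g i)) // cZ oppr0.
  case: x => [v|h|h|h|h]; rewrite !eq_EbasisE /=; try by case: r => [|y s]; rewrite !oppr0.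
    by rewrite [_ == v]eq_sym; case: (v == _) => //; case: r => [|y s]; rewrite !oppr0.
  by case: (h == i) => //; case: r => [|y s]; rewrite !oppr0.
have cB t : simple_diff None None (prefixed (bB g i) (prefixed (bA g i) (loop_power b))) t = 0.
  case: t => [|x r] //; rewrite (@simple_diff_prefixed None (bB g i)) // cA oppr0.
  case: x => [v|h|h|h|h]; rewrite !eq_EbasisE /=; try by case: r => [|y s]; rewrite !oppr0.
    by case: v => [v|] //=; case: r => [|y s]; rewrite !oppr0.
  by case: (h == i) => //; case: r => [|y s]; rewrite !oppr0.
case: w => [|x r] //; rewrite simple_diffD (@simple_diff_prefixed None (bB g i)) //
  (@simple_diff_prefixed None X1) // cB oppr0.
case: x => [v|h|h|h|h]; rewrite !eq_EbasisE /=; try by case: r => [|y s]; rewrite !oppr0 addr0.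
- case: v => [v|] /=; last by rewrite addr0.
  by case: r => [|y s]; rewrite !oppr0 addr0.
- case: (eqVneq h i) => [->|hi].
    rewrite x1i eqxx; case: r => [|y r]; first by rewrite /= !oppr0 addr0.
    rewrite (@simple_diff_prefixed None (bY g i)) // cA oppr0 -[Some (bA g i) == _]/(bA g i == y).
    case: (eqVneq (bA g i) y) => [<-|yA].
      rewrite !eq_EbasisE /= eqxx; case: r => [|y0 s]; first by rewrite /= !oppr0 addr0.
      rewrite /= -[Some (bB g i) == _]/(bB g i == y0) eq_sym; case: (y0 == _).
        by rewrite opprK subrr.
      by rewrite !oppr0 addr0.
    rewrite subr0; case: y yA => [v|l|l|l|l]; rewrite !eq_EbasisE /=;
      try by case: r => [|y0 s]; rewrite !oppr0.
    - by rewrite [_ == v]eq_sym; case: (v == _); rewrite ?oppr0 //; case: r => [|y0 s];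
      rewrite !oppr0.
    - by move=> il; rewrite [l == i]eq_sym (negPf il); case: r => [|y0 s]; rewrite !oppr0.
    - by case: (l == i); rewrite ?oppr0 //; case: r => [|y0 s]; rewrite !oppr0.
  have hx : (h == x1 :> nat) = false.
    by apply/eqP => hx; case/eqP: hi; apply: val_inj; rewrite /= hx x1i.
  by rewrite hx; case: r => [|y s]; rewrite !oppr0 addr0.
- case: (h == x1); first by case: r => [|y s]; rewrite !oppr0 addr0.
  by case: r => [|y s]; rewrite !oppr0 addr0.
Qed.

Definition witness b : seq B := [:: Z, bB g i, bY g i, bA g i & nseq b Z].

Lemma loop_power_nseq b : loop_power b (nseq b Z) = 1.
Proof. by elim: b => [|b IH] //=; rewrite eqxx. Qed.

Lemma loop_cocycle_witness b : loop_cocycle b (witness b) = 1.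
Proof.
by rewrite /loop_cocycle /witness /= !eqxx /= loop_power_nseq addr0.
Qed.

Lemma loop_power_wdeg b w : loop_power b w != 0 -> wdeg w = b.
Proof.
elim: b w => [|b IH] w; last by move=> /(prefixed_wdeg IH) ->.
by rewrite /loop_power /= /empty_word; case: (w =P [::]) => [->|]; rewrite ?eqxx.
Qed.

Lemma loop_cocycle_wdeg b w : loop_cocycle b w != 0 -> wdeg w = (b + 3)%N.
Proof.
have dA := prefixed_wdeg (l := bA g i) (@loop_power_wdeg b).
have -> : (b + 3)%N%:Z = (Edeg Z)%:Z + (1 + (1 + (0 + b%:Z))) by rewrite /=; lia.
apply: prefixed_wdeg => t.
case: (eqVneq (prefixed (bB g i) (prefixed (bY g i) (prefixed (bA g i) (loop_power b))) t) 0) => [->|+ _].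
  by rewrite add0r => /(prefixed_wdeg (prefixed_wdeg dA)) ->.
by move=> /(prefixed_wdeg (prefixed_wdeg dA)) ->.
Qed.

Definition loop_cochain b w : E := loop_cocycle b w *: Evec k X1.

Lemma loop_cochain_coord b w c : loop_cochain b w c = (c == X1)%:R * loop_cocycle b w.
Proof. by rewrite /loop_cochain coordZ ffunE mulrC. Qed.

Lemma loop_cochain_homog b : homog_words b.+4 (2 - b.+4%:Z) (loop_cochain b).
Proof.
move=> w wb c; rewrite loop_cochain_coord; case: (c =P X1) => [->|_]; last by rewrite mul0r eqxx.
by rewrite mul1r => /loop_cocycle_wdeg ->; rewrite /=; lia.
Qed.

(** The value [X_1] has the top rank, so no coordinate of lower rank interferes and the scalar
    cocycle identity suffices. *)
Lemma loop_cochain_closed j b w : word_diff j (loop_cochain b) w = 0.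
Proof.
apply/ffunP => c; rewrite coord_word_diff_low => [|t b' _ cb]; last first.
  rewrite loop_cochain_coord; case: eqP => [b'X|_]; last exact: mul0r.
  by move: cb; rewrite b'X; case: (c) => [[]||||].
rewrite [RHS]ffunE; case: (eqVneq c X1) => [->|cX].
  by rewrite -[RHS](loop_cocycle_closed b w); apply: eq_simple_diff => t;
    rewrite loop_cochain_coord eqxx mul1r.
by apply: simple_diff0 => t; rewrite loop_cochain_coord (negPf cX) mul0r.
Qed.

Lemma coord_merges_path (F : seq B -> E) c x r : path (fun y y' => Ebasis_mul y y' == None) x r ->
  rdiv c (last x r) = None -> coord_merges_word F c (x :: r) = 0 :> k.
Proof.
elim: r x F => [|y r IH] x F; first by rewrite /= => _ ->; rewrite subr0.
by case/andP=> /= /eqP xy pr lr; rewrite xy sub0r; have /= -> := IH y (F \o cons x) pr lr;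
  rewrite oppr0.
Qed.

Lemma HH_nonvanish m : (4 <= m)%N -> ~ HH_eq0 (Egr k g n) m.+1 (2 - m.+1%:Z).
Proof.
(* The exponent [b.+1] is positive, so that the witness also ends with [Z]; this uses cochain length
   at least 5. *)
case: m => [|[|[|[|b]]]] // _ /HH_eq0_words /(_ _ (@loop_cochain_homog b.+1)).
case=> [w _|H _ HE]; first exact: loop_cochain_closed.
have /(congr1 (fun v : E => v X1)) : loop_cochain b.+1 (witness b.+1) =
    word_diff (2 - b.+4.+1%:Z) H (witness b.+1).
  by apply: HE; rewrite /= size_nseq.
have zx1 : (z == x1) = false.
  by apply/eqP => zx; move: zn; rewrite zx x1i leqNgt ltn_ord.
rewrite loop_cochain_coord eqxx mul1r loop_cocycle_witness /witness coord_word_diff coord_merges_path.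
- by rewrite /= zx1 mulr0 subr0 => /eqP; rewrite oner_eq0.
- by rewrite /=; elim: b {HE} => //= c ->.
- have -> : last Z [:: bB g i, bY g i, bA g i & nseq b.+1 Z] = Z by rewrite /=; elim: b {HE}.
  by rewrite /= zx1.
Qed.

End Cocycle.
End Part_ii.

Theorem theorem1p3p1 (k : fieldType) :
  ((forall g : nat, (1 <= g)%N ->
      forall i : nat, (8 < i)%N -> HH_eq0 (Egr k g g) i (2 - i%:Z))
   /\
   (forall g : nat, (1 < g)%N ->
      forall i : nat, (6 < i)%N -> HH_eq0 (Egr k g g) i (2 - i%:Z)))
  /\
  (forall g n : nat, (1 <= n)%N -> (n < g)%N ->
     forall i : nat, (5 <= i)%N -> ~ HH_eq0 (Egr k g n) i (2 - i%:Z)).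
Proof.
split; [split=> g g1 [|i] // i8 | move=> g [|n] // _ ng [|i] // i5].
- by apply: HH_vanish => [|i9]; [apply: leq_trans i8 | rewrite ltnNge i9 in i8].
- exact: HH_vanish.
(* Indices start at 0: [Z] has index [n.+1], the number of points, and is the first [X] attached to
   no point; [X_1] has index 0. *)
by apply: (@HH_nonvanish k g n.+1 ord0 (Ordinal ng) (Ordinal (leq_ltn_trans (leq0n _) ng))).
Qed.
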